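(* Let $E$ be a real Banach lattice and let $S$ be a positive, bounded and irreducible $C_0$-semigroup on $E$ with generator $A$, and assume that $S$ is eventually norm continuous. Then precisely one of the following four situations occurs: (i) $\dim(\ker A')=0$; in this case $S(t)f\to0$ as $t\to\infty$ for each $f\in E$. (ii) $\dim(\ker A')=1$ and $\dim(\ker A)=1$; in this case there exist a quasi-interior point $u\in E_+$ and a strictly positive functional $\varphi\in E'$ such that $S(t)f\to\langle\varphi,f\rangle u$ as $t\to\infty$ for each $f\in E$. (iii) $\dim(\ker A')=1$ and $\dim(\ker A)=0$; in this case $S(t)$ does not converge strongly as $t\to\infty$. (iv) $\dim(\ker A')\ge2$; in this case $S(t)$ does not converge strongly as $t\to\infty$.
   Context: A $C_0$-semigroup is a map $S:(0,\infty)\to\mathcal{L}(E)$ with $S(s+t)=S(t)S(s)$, locally bounded near $0$, and $S(t)f\to f$ as $t\downarrow0$ for every $f$; its generator is $Af=\lim_{t\downarrow0}(S(t)f-f)/t$ on the set of $f$ where this limit exists, and $A'$ is its dual (adjoint) operator on $E'$. $S$ is bounded if $\sup_{t>0}\|S(t)\|<\infty$, positive if each $S(t)$ maps $E_+$ into $E_+$, and eventually norm continuous if there is $t_0\ge0$ such that $t\mapsto S(t)$ is continuous in operator norm on $(t_0,\infty)$. A positive semigroup is irreducible if for every $0<f\in E$ and $0<\varphi\in E'$ (where $0<x$ means $x\ge0,x\ne0$) there is $t>0$ with $\langle\varphi,S(t)f\rangle>0$. A vector $u\in E_+$ is a quasi-interior point if $\lim_{n\to\infty}v\wedge(nu)=v$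 for all $v\in E_+$; $\varphi\in E'$ is strictly positive if $\langle\varphi,f\rangle>0$ for all $0<f\in E$. *)

(* Defs.v *)
From HB Require Import structures.
From mathcomp Require Import all_boot all_order all_algebra.
From mathcomp Require Import all_classical all_reals all_analysis.
Set Implicit Arguments. Unset Strict Implicit. Unset Printing Implicit Defensive.
Import Order.TTheory GRing.Theory Num.Theory.
Import numFieldNormedType.Exports.
Local Open Scope ring_scope.
Local Open Scope classical_set_scope.

Record banach_lattice (R : realType) (E : normedModType R) := BanachLattice {
  bl_le : E -> E -> Prop;
  bl_join : E -> E -> E;
  bl_le_refl : forall x, bl_le x x;
  bl_le_anti : forall x y, bl_le x y -> bl_le y x -> x = y;
  bl_le_trans : forall x y z, bl_le x y -> bl_le y z -> bl_le x z;
  bl_le_add : forall x y z, bl_le x y -> bl_le (x + z) (y + z);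
  bl_le_scale : forall (a : R) x y, 0 <= a -> bl_le x y -> bl_le (a *: x) (a *: y);
  bl_join_ubl : forall x y, bl_le x (bl_join x y);
  bl_join_ubr : forall x y, bl_le y (bl_join x y);
  bl_join_lub : forall x y z, bl_le x z -> bl_le y z -> bl_le (bl_join x y) z;
  bl_norm_mono : forall x y,
    bl_le (bl_join x (- x)) (bl_join y (- y)) -> `|x| <= `|y|
}.

Section Defs.
Context {R : realType} {E : normedModType R} (L : banach_lattice E).

Definition bl_meet (x y : E) : E := - bl_join L (- x) (- y).
Definition bl_pos (x : E) : Prop := bl_le L 0 x.
Definition bl_strict_pos (x : E) : Prop := bl_pos x /\ x <> 0.

Definition is_dual (phi : E -> R) : Prop :=
  (forall (a : R) (x y : E), phi (a *: x + y) = a * phi x + phi y) /\ continuous phi.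

Definition dual_pos (phi : E -> R) : Prop := forall f, bl_pos f -> 0 <= phi f.
Definition dual_strict_pos (phi : E -> R) : Prop :=
  dual_pos phi /\ exists f, phi f <> 0.

Definition strictly_positive (phi : E -> R) : Prop :=
  is_dual phi /\ forall f, bl_strict_pos f -> 0 < phi f.

Definition quasi_interior (u : E) : Prop :=
  bl_pos u /\ forall v, bl_pos v -> (fun n : nat => bl_meet v (n%:R *: u)) @ \oo --> v.

(* C0-semigroup S : (0,oo) -> L(E) (values at t <= 0 are irrelevant) *)
Definition C0_semigroup (S : R -> E -> E) : Prop :=
  (forall t, 0 < t -> (forall (a : R) (x y : E), S t (a *: x + y) = a *: S t x + S t y)
                      /\ continuous (S t)) /\
  (forall s t, 0 < s -> 0 < t -> forall f, S (s + t) f = S t (S s f)) /\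
  (exists delta M : R, 0 < delta /\ forall t, 0 < t < delta -> forall f, `|S t f| <= M * `|f|) /\
  (forall f, S^~ f @ 0^'+ --> f).

Definition sg_bounded (S : R -> E -> E) : Prop :=
  exists M : R, forall t, 0 < t -> forall f, `|S t f| <= M * `|f|.

Definition sg_positive (S : R -> E -> E) : Prop :=
  forall t, 0 < t -> forall f, bl_pos f -> bl_pos (S t f).

Definition sg_irreducible (S : R -> E -> E) : Prop :=
  forall f phi, bl_strict_pos f -> is_dual phi -> dual_strict_pos phi ->
    exists t, 0 < t /\ 0 < phi (S t f).

(* continuity in operator norm on (t0, oo), written out:
   ||S s - S t|| <= eps  iff  forall f, |S s f - S t f| <= eps |f| *)
Definition eventually_norm_continuous (S : R -> E -> E) : Prop :=
  exists t0 : R, 0 <= t0 /\ forall t, t0 < t -> forall eps : R, 0 < eps ->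
    exists delta : R, 0 < delta /\ forall s, t0 < s -> `|s - t| < delta ->
      forall f, `|S s f - S t f| <= eps * `|f|.

(* graph of the generator A: f \in D(A) and A f = g *)
Definition generator (S : R -> E -> E) (f g : E) : Prop :=
  (fun t => t^-1 *: (S t f - f)) @ 0^'+ --> g.

Definition ker_gen (S : R -> E -> E) (f : E) : Prop := generator S f 0.

(* kernel of the dual operator A' : phi \in D(A') with A' phi = 0,
   i.e. phi \in E' and <phi, A f> = 0 for all f \in D(A) *)
Definition ker_dual_gen (S : R -> E -> E) (phi : E -> R) : Prop :=
  is_dual phi /\ forall f g, generator S f g -> phi g = 0.

Definition dim0 (K : E -> Prop) : Prop := forall x, K x -> x = 0.
Definition dim1 (K : E -> Prop) : Prop :=
  exists v, K v /\ v <> 0 /\ forall x, K x -> exists c : R, x = c *: v.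

Definition ddim0 (K : (E -> R) -> Prop) : Prop :=
  forall phi, K phi -> forall f, phi f = 0.
Definition ddim1 (K : (E -> R) -> Prop) : Prop :=
  exists psi, K psi /\ (exists f, psi f <> 0) /\
    forall phi, K phi -> exists c : R, forall f, phi f = c * psi f.
Definition ddim_ge2 (K : (E -> R) -> Prop) : Prop :=
  exists phi psi, K phi /\ K psi /\
    forall a b : R, (forall f, a * phi f + b * psi f = 0) -> a = 0 /\ b = 0.

Definition strongly_convergent (S : R -> E -> E) : Prop :=
  forall f, exists g : E, S^~ f @ +oo --> g.

End Defs.

(* Main.v *)
Require Import Defs.
From HB Require Import structures.
From mathcomp Require Import all_boot all_order all_algebra.
From mathcomp Require Import all_classical all_reals all_analysis.
From mathcomp Require Import ring lra.
Import Order.TTheory GRing.Theory Num.Theory.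
Import numFieldNormedType.Exports.
Local Open Scope ring_scope.
Local Open Scope classical_set_scope.
Set Implicit Arguments. Unset Strict Implicit. Unset Printing Implicit Defensive.

(** The heart of the matter is that every bounded complete trajectory
    [X : R -> E'] of the dual semigroup, [X r = X (r + t) \o S t], is constant.
    Such trajectories form a vector lattice, with
    [X^+ r f = sup {X (r + t) g | t > 0, 0 <= g <= S t f}], on which the shifts
    act as a group of positive operators; eventual norm continuity makes the shift
    [U] by a small time close in norm to the identity.  Hence [U] preserves
    disjointness: if [v] and [z] are disjoint and [0 <= w <= v], [w <= U z], then
    [w] and [U^-1 w] are disjoint, so [|w| <= C |w - U^-1 w|] forces [w = 0].
    For [X >= 0], [T = lam U] with [lam < 1], [z = (X - T X)^+] and
    [v = (T X - X)^+], the inequality [X <= T X + z] gives [v <= T^n X] for all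
    [n] by induction, so [v = 0]; letting [lam] tend to [1], [U X <= X], and
    boundedness turns this into equality.

    If [S t f] does not tend to [0], then norming functionals [psi_t] at [S t f]
    and an ultrafilter limit of [psi_t \o S (t - r)] along [t -> oo] produce a
    trajectory, hence an invariant functional, which does not vanish at [f].
    So [S t f -> 0] as soon as [f] is annihilated by [ker A'].  Irreducibility
    does the rest: a nonzero [ker A'] contains a strictly positive functional,
    positive fixed vectors are quasi-interior, and [dim (ker A) <= 1]. *)

(** * Linear functionals *)

Section LinearFunctionals.
Context {R : realType} {V : lmodType R}.

Definition lin_form (phi : V -> R) :=
  forall (a : R) x y, phi (a *: x + y) = a * phi x + phi y.

Variables (phi : V -> R) (lin : lin_form phi).

Lemma lin_formD x y : phi (x + y) = phi x + phi y.
Proof. by have := lin 1 x y; rewrite scale1r mul1r. Qed.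

Lemma lin_form0 : phi 0 = 0.
Proof. by have := lin_formD 0 0; rewrite addr0; lra. Qed.

Lemma lin_formZ (a : R) x : phi (a *: x) = a * phi x.
Proof. by have := lin a x 0; rewrite lin_form0 !addr0. Qed.

Lemma lin_formN x : phi (- x) = - phi x.
Proof. by rewrite -scaleN1r lin_formZ mulN1r. Qed.

Lemma lin_formB x y : phi (x - y) = phi x - phi y.
Proof. by rewrite lin_formD lin_formN. Qed.

End LinearFunctionals.

(** * The Hahn-Banach theorem for sublinear functionals *)

Section HahnBanach.
Context {R : realType} {V : lmodType R}.
Implicit Types (p q : V -> R) (x y : V).

(** Homogeneity is asked as one inequality, a form that passes easily to infima; the inverse scalar
    gives the other inequality. *)
Definition sublinear p :=
  (forall x y, p (x + y) <= p x + p y) /\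
  (forall (a : R) x, 0 < a -> p (a *: x) <= a * p x).

Lemma sublinear0 p : sublinear p -> p 0 = 0.
Proof.
move=> [_ pZ].
have h1 : p 0 <= 2^-1 * p 0 by rewrite -[in leLHS](scaler0 _ 2^-1); apply: pZ.
have h2 : p 0 <= 2 * p 0 by rewrite -[in leLHS](scaler0 _ 2); apply: pZ.
lra.
Qed.

Lemma sublinearZ p (a : R) x : sublinear p -> 0 <= a -> p (a *: x) = a * p x.
Proof.
move=> sp; rewrite le_eqVlt => /predU1P[<-|a0].
  by rewrite scale0r mul0r sublinear0.
apply/eqP; rewrite eq_le sp.2//=.
have := sp.2 a^-1 (a *: x); rewrite invr_gt0 scalerA mulVf ?gt_eqF// scale1r.
by move=> /(_ a0); rewrite ler_pdivlMl.
Qed.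

Lemma sublinearN_ge p x : sublinear p -> - p (- x) <= p x.
Proof.
move=> sp; have := sp.1 x (- x); rewrite subrr sublinear0//; lra.
Qed.

(** Serves three times: for lowering a functional in one direction, for chains in Zorn's lemma, and
    for a distance to the multiples of a vector measured on positive parts. The lower bounds keep
    the real infimum meaningful. *)
Lemma sublinear_inf (I : Type) (A : set I) (F : I -> V -> R) :
  A !=set0 ->
  (forall x, exists b, forall i, A i -> b <= F i x) ->
  (forall i j x y, A i -> A j -> exists2 k, A k & F k (x + y) <= F i x + F j y) ->
  (forall i (a : R) x, A i -> 0 < a -> exists2 k, A k & F k (a *: x) <= a * F i x) ->
  sublinear (fun x => inf [set F i x | i in A]) /\
  forall i x, A i -> inf [set F j x | j in A] <= F i x.
Proof.
move=> [i0 Ai0] lbF FD FZ.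
have ne x : [set F i x | i in A] !=set0 by exists (F i0 x); exists i0.
have infle i x : A i -> inf [set F j x | j in A] <= F i x.
  move=> Ai; apply: ge_inf; last by exists i.
  by have [b hb] := lbF x; exists b => _ [j Aj <-]; apply: hb.
split=> //; split=> [x y|a x a0].
- rewrite -lerBlDr; apply: lb_le_inf => // _ [i Ai <-].
  rewrite lerBlDr -lerBlDl; apply: lb_le_inf => // _ [j Aj <-].
  rewrite lerBlDl; have [k Ak hk] := FD i j x y Ai Aj.
  exact: le_trans (infle _ _ Ak) hk.
- rewrite -ler_pdivrMl//; apply: lb_le_inf => // _ [i Ai <-].
  rewrite ler_pdivrMl//; have [k Ak hk] := FZ i a x Ai a0.
  exact: le_trans (infle _ _ Ak) hk.
Qed.

(** The infimum over [t >= 0] of [p (x + t *: y) - t * p y] works: [t = 0] gives the bound by [p],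
    and [t = 1] the value at [- y]. *)
Lemma sublinear_lower p y : sublinear p ->
  exists p', [/\ sublinear p', forall x, p' x <= p x & p' (- y) <= - p y].
Proof.
move=> sp; pose F (t : R) x := p (x + t *: y) - t * p y.
have [] := @sublinear_inf R [set t | 0 <= t] F.
- by exists 0 => /=.
- move=> x; exists (- p (- x)) => t /= t0; rewrite /F.
  have := sp.1 (- x) (x + t *: y).
  by rewrite addrA addNr add0r sublinearZ//; lra.
- move=> s t x z /= s0 t0; exists (s + t); first exact: addr_ge0.
  rewrite /F scalerDl.
  have -> : x + z + (s *: y + t *: y) = (x + s *: y) + (z + t *: y) by rewrite addrACA.
  by have := sp.1 (x + s *: y) (z + t *: y); lra.
- move=> s a x /= s0 a0; exists (a * s); first by rewrite mulr_ge0// ltW.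
  rewrite /F -scalerA -scalerDr sublinearZ ?(ltW a0)//.
  by rewrite mulrBr mulrA.
move=> sinf infle; exists (fun x => inf [set F i x | i in [set t | 0 <= t]]).
split=> // [x|].
  by apply: le_trans (infle 0 x _) _ => //=; rewrite /F scale0r addr0 mul0r subr0.
apply: le_trans (infle 1 _ _) _ => //=.
by rewrite /F scale1r addNr sublinear0// mul1r sub0r.
Qed.

(** Zorn's lemma on the sublinear functionals below [q], ordered downwards; along a chain the
    pointwise infimum stays above [- q (- x)], hence is finite. *)
Lemma minimal_sublinear q : sublinear q ->
  exists p, [/\ sublinear p, forall x, p x <= q x &
    forall p', sublinear p' -> (forall x, p' x <= p x) -> forall x, p x <= p' x].
Proof.
move=> sq.
pose T := {p | sublinear p /\ forall x, p x <= q x}.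
pose t0 : T := exist _ q (conj sq (fun x => lexx (q x))).
pose Rel (s t : T) := `[< forall x, sval t x <= sval s x >].
have [||A totA|[p [sp pq]] pmin] := @ZL_preorder T t0 Rel.
- by move=> t; apply/asboolP.
- move=> s t u /asboolP h1 /asboolP h2; apply/asboolP => x.
  exact: le_trans (h2 x) (h1 x).
- have [[a Aa]|nA] := pselect (A !=set0); last first.
    by exists t0 => s As; exfalso; apply: nA; exists s.
  have [] := @sublinear_inf T A (fun t => sval t).
  + by exists a.
  + move=> x; exists (- q (- x)) => -[p [sp pq]] _ /=.
    by apply: le_trans (sublinearN_ge x sp); rewrite lerN2.
  + move=> s t x y As At.
    have [st|ts] := totA _ _ As At.
      exists t => //; move/asboolP: st => /(_ x) stx.
      by have := (svalP t).1.1 x y; lra.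
    exists s => //; move/asboolP: ts => /(_ y) tsy.
    by have := (svalP s).1.1 x y; lra.
  + by move=> s c x As c0; exists s => //; apply: (svalP s).1.2.
  move=> sinf infle.
  have infq x : inf [set sval t x | t in A] <= q x.
    exact: le_trans (infle _ _ Aa) ((svalP a).2 x).
  by exists (exist (fun p => sublinear p /\ forall x, p x <= q x) _ (conj sinf infq)) => s As; apply/asboolP => x /=; apply: infle.
- exists p; split=> // p' sp' p'p.
  have p'q x : p' x <= q x by exact: le_trans (p'p x) (pq x).
  move=> x; have := pmin (exist (fun p => sublinear p /\ forall x, p x <= q x) p' (conj sp' p'q)).
  by move=> /(_ (introT (asboolP _) p'p)) /asboolP; apply.
Qed.

Theorem hahn_banach q v : sublinear q ->
  exists phi : V -> R,
    [/\ lin_form phi,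
        forall x, phi x <= q x & phi v = q v].
Proof.
(* Lowering [q] at [v] beforehand forces [p (- v) <= - q v], so that the odd functional [p] attains
   [q v] at [v]. *)
move=> sq; have [qv [sqv qvq qvN]] := sublinear_lower v sq.
have [p [sp pqv pmin]] := minimal_sublinear sqv.
(* Minimality and [sublinear_lower] make [p] odd, hence linear. *)
have odd y : p (- y) = - p y.
  have [p' [sp' p'p p'y]] := sublinear_lower y sp.
  apply/eqP; rewrite eq_le (le_trans (pmin _ sp' p'p _) p'y)/=.
  by have := sublinearN_ge (- y) sp; rewrite opprK.
have add x y : p (x + y) = p x + p y.
  apply/eqP; rewrite eq_le sp.1/=.
  by have := sp.1 (x + y) (- y); rewrite addrK odd; lra.
exists p; split=> [a x y|x|].
- rewrite add; congr (_ + _); have [a0|a0] := leP 0 a; first exact: sublinearZ.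
  have := @sublinearZ p (- a) x sp; rewrite oppr_ge0 (ltW a0) => /(_ isT).
  by rewrite scaleNr odd mulNr => /oppr_inj.
- exact: le_trans (pqv x) (qvq x).
- apply/eqP; rewrite eq_le (le_trans (pqv v) (qvq v))/=.
  by have := le_trans (pqv (- v)) qvN; rewrite odd lerN2.
Qed.

End HahnBanach.

Section NormFunctional.
Context {R : realType} {E : normedModType R}.

Lemma norming_functional (x : E) : exists phi : E -> R,
  [/\ lin_form phi,
      forall y, `|phi y| <= `|y| & phi x = `|x|].
Proof.
have [|phi [lin le eq]] := @hahn_banach R E (fun y => `|y|) x.
  split=> [y z|a y a0]; first exact: ler_normD.
  by rewrite normrZ gtr0_norm.
exists phi; split=> // y; rewrite ler_norml le andbT.
by have := le (- y); rewrite lin_formN// normrN; lra.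
Qed.

End NormFunctional.

(** * Vector lattices *)

Section BanachLattice.
Context {R : realType} {E : normedModType R} (L : banach_lattice E).
Implicit Types x y f g : E.
Local Notation pos := (bl_pos L).
Local Notation le := (bl_le L).

Definition pospart x : E := bl_join L x 0.

Lemma bl_subr_pos x y : pos (y - x) <-> le x y.
Proof.
split=> h; first by have := bl_le_add x h; rewrite add0r subrK.
by have := bl_le_add (- x) h; rewrite subrr.
Qed.

Lemma bl_pos0 : pos 0. Proof. exact: bl_le_refl. Qed.

Lemma bl_posD x y : pos x -> pos y -> pos (x + y).
Proof.
move=> x0 y0; apply: (bl_le_trans y0).
by have := bl_le_add y x0; rewrite add0r.
Qed.

Lemma bl_posZ (a : R) x : 0 <= a -> pos x -> pos (a *: x).
Proof. by move=> a0 x0; have := bl_le_scale a0 x0; rewrite scaler0. Qed.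

Lemma bl_pos_anti x : pos x -> pos (- x) -> x = 0.
Proof.
move=> x0 xN; apply: (bl_le_anti (b := L)) => //.
by apply/bl_subr_pos; rewrite sub0r.
Qed.

Lemma pospart_pos x : pos (pospart x). Proof. exact: bl_join_ubr. Qed.

Lemma pospart_ge x : pos (pospart x - x).
Proof. by apply/bl_subr_pos; exact: bl_join_ubl. Qed.

Lemma pospart_least x y : pos y -> pos (y - x) -> pos (y - pospart x).
Proof. by move=> y0 /bl_subr_pos yx; apply/bl_subr_pos; exact: bl_join_lub. Qed.

Lemma pospartN x : pospart (- x) = pospart x - x.
Proof.
apply: (bl_le_anti (b := L)); apply/bl_subr_pos.
  by apply: pospart_least; rewrite ?opprK ?subrK; [exact: pospart_ge|exact: pospart_pos].
have -> : pospart (- x) - (pospart x - x) = pospart (- x) + x - pospart x.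
  by rewrite opprB addrA.
have h := pospart_ge (- x); rewrite opprK in h.
by apply: pospart_least => //; rewrite addrK; exact: pospart_pos.
Qed.

Lemma pospart_decomp x : x = pospart x - pospart (- x).
Proof. by rewrite pospartN opprB addrC subrK. Qed.

(** The vector [x^+ - w] is positive and lies above [x], because subtracting [x] from it leaves
    [x^- - w]; minimality of [x^+] then gives [w <= 0]. *)
Lemma pospart_disjoint x w : pos w -> pos (pospart x - w) ->
  pos (pospart (- x) - w) -> w = 0.
Proof.
move=> w0 w1 w2; apply: bl_pos_anti => //.
have h : pos (pospart x - w - x) by rewrite addrAC -pospartN.
by have := pospart_least w1 h; rewrite addrAC subrr add0r.
Qed.

Lemma bl_meetE x y : bl_meet L x y = x - pospart (x - y).
Proof.
rewrite /bl_meet -[RHS]opprK; congr (- _); rewrite opprB.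
apply: (bl_le_anti (b := L)).
  apply: bl_join_lub; apply/bl_subr_pos.
    by rewrite opprK subrK; exact: pospart_pos.
  by have := pospart_ge (x - y); rewrite opprB [y - x]addrC addrA opprK.
apply/bl_subr_pos; rewrite opprB addrA.
apply: pospart_least.
  by have /bl_subr_pos := bl_join_ubl L (- x) (- y); rewrite opprK.
rewrite opprB [y - x]addrC addrA addrK.
by have /bl_subr_pos := bl_join_ubr L (- x) (- y); rewrite opprK.
Qed.

Lemma riesz_decomposition g x y : pos x -> pos y -> pos g -> pos (x + y - g) ->
  exists g1 g2, [/\ g = g1 + g2, pos g1, pos g2, pos (x - g1) & pos (y - g2)].
Proof.
(* The first piece is the meet of [g] and [x]. *)
move=> x0 y0 g0 gxy; exists (g - pospart (g - x)), (pospart (g - x)).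
split; first by rewrite subrK.
- by apply: pospart_least => //; rewrite opprB addrC subrK.
- exact: pospart_pos.
- have -> : x - (g - pospart (g - x)) = pospart (g - x) - (g - x).
    by rewrite !opprB addrCA addrA addrAC -addrA.
  exact: pospart_ge.
- apply: pospart_least => //.
  by have -> : y - (g - x) = x + y - g by rewrite opprB addrA [y + x]addrC.
Qed.

(** Twice the absolute value dominates [x + (- x) = 0]. *)
Lemma bl_abs_pos x : pos (bl_join L x (- x)).
Proof.
have h : pos (bl_join L x (- x) + bl_join L x (- x)).
  have /bl_subr_pos h1 := bl_join_ubl L x (- x).
  have /bl_subr_pos h2 := bl_join_ubr L x (- x).
  by have := bl_posD h1 h2; rewrite opprK addrACA addNr addr0.
set j := bl_join L x (- x) in h *.
have -> : j = 2^-1 *: (j + j).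
  by rewrite scalerDr -scalerDl -[2^-1]div1r -splitr scale1r.
by apply: bl_posZ => //; rewrite invr_ge0.
Qed.

Lemma bl_abs_id x : pos x -> bl_join L x (- x) = x.
Proof.
move=> x0; apply: (bl_le_anti (b := L)); last exact: bl_join_ubl.
apply: bl_join_lub; first exact: bl_le_refl.
by apply/bl_subr_pos; rewrite opprK; exact: bl_posD.
Qed.

Lemma bl_norm_le x y : pos x -> pos (y - x) -> `|x| <= `|y|.
Proof.
move=> x0 yx; apply: (bl_norm_mono (b := L)).
have y0 : pos y by rewrite -[y](subrK x); exact: bl_posD.
by rewrite !bl_abs_id//; apply/bl_subr_pos.
Qed.

Lemma norm_pospart x : `|pospart x| <= `|x|.
Proof.
apply: (@le_trans _ _ `|bl_join L x (- x)|).
  apply: bl_norm_le; first exact: pospart_pos.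
  by apply: pospart_least; [exact: bl_abs_pos|apply/bl_subr_pos; exact: bl_join_ubl].
apply: (bl_norm_mono (b := L)).
by rewrite (bl_abs_id (bl_abs_pos x)); exact: bl_le_refl.
Qed.

End BanachLattice.

Lemma geometric_le0 (R : realType) (q C x : R) : 0 <= q < 1 ->
  (forall n, x <= C * q ^+ n) -> x <= 0.
Proof.
move=> /andP[q0 q1] xle; have q1' : `|q| < 1 by rewrite ger0_norm.
by apply: (cvgr_to_ge (cvg_geometric C q1')); apply: nearW => n; exact: xle.
Qed.

Lemma natmul_le0 (R : realType) (d C : R) : (forall n, n%:R * d <= C) -> d <= 0.
Proof.
move=> dC; rewrite leNgt; apply/negP => d0.
have := dC (Num.truncn (C / d)).+1; rewrite -ler_pdivlMr// leNgt.
by rewrite truncnS_gt.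
Qed.

(** * Extension of functionals from the positive cone *)

Section ConeExtension.
Context {R : realType} {E : normedModType R} (L : banach_lattice E).
Local Notation pos := (bl_pos L).

(** The extension is [s f^+ - s f^-]; additivity makes [s a - s b] depend only on [a - b], whence
    linearity. Both terms lie between 0 and [C * |f|], so the constant [C] is not doubled. *)
Lemma cone_extension (s : E -> R) (C : R) :
  (forall x y, pos x -> pos y -> s (x + y) = s x + s y) ->
  (forall (a : R) x, 0 < a -> pos x -> s (a *: x) = a * s x) ->
  (forall x, pos x -> 0 <= s x <= C * `|x|) -> 0 <= C ->
  exists phi, [/\ lin_form phi, forall x, pos x -> phi x = s x &
                  forall x, `|phi x| <= C * `|x|].
Proof.
move=> sD sZ sC C0.
have s0 : s 0 = 0 by have := sD 0 0 (bl_pos0 L) (bl_pos0 L); rewrite addr0; lra.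
pose phi f := s (pospart L f) - s (pospart L (- f)).
have key x a b : pos a -> pos b -> x = a - b -> phi x = s a - s b.
  move=> a0 b0 xab; rewrite /phi.
  have e : pospart L x + b = pospart L (- x) + a.
    by rewrite pospartN -addrA; congr (_ + _); rewrite xab opprB subrK.
  have := sD _ _ (pospart_pos L x) b0.
  by rewrite e (sD _ _ (pospart_pos L (- x)) a0); lra.
exists phi; split.
- move=> a x y; have [a0|a0|->] := ltgtP a 0; last first.
  + by rewrite scale0r add0r mul0r add0r.
  + have dec : a *: x + y = (a *: pospart L x + pospart L y) -
      (a *: pospart L (- x) + pospart L (- y)).
      by rewrite opprD addrACA -scalerBr -!pospart_decomp.
    have h z : pos (a *: pospart L z) by apply: bl_posZ (pospart_pos L z); rewrite ltW.
    have hD z z' := bl_posD (h z) (pospart_pos L z').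
    rewrite (key _ _ _ (hD _ _) (hD _ _) dec) !sD ?sZ//; try exact: pospart_pos.
    by rewrite /phi; lra.
  + have dec : a *: x + y = ((- a) *: pospart L (- x) + pospart L y) -
      ((- a) *: pospart L x + pospart L (- y)).
      rewrite opprD addrACA -scalerBr -pospart_decomp.
      by rewrite scaleNr -scalerN opprB -pospart_decomp.
    have Na0 : 0 < - a by lra.
    have h z : pos (- a *: pospart L z) by apply: bl_posZ (pospart_pos L z); rewrite ltW.
    have hD z z' := bl_posD (h z) (pospart_pos L z').
    rewrite (key _ _ _ (hD _ _) (hD _ _) dec) !sD ?sZ//; try exact: pospart_pos.
    by rewrite /phi; lra.
- by move=> x x0; rewrite (key x x 0) ?s0 ?subr0//; exact: bl_pos0.
- move=> x; have /andP[p1 p2] := sC _ (pospart_pos L x).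
  have /andP[n1 n2] := sC _ (pospart_pos L (- x)).
  have h1 : C * `|pospart L x| <= C * `|x| by rewrite ler_wpM2l// norm_pospart.
  have h2 : C * `|pospart L (- x)| <= C * `|x|.
    by rewrite ler_wpM2l//; apply: le_trans (norm_pospart _ _) _; rewrite normrN.
  by rewrite /phi ler_norml; lra.
Qed.

End ConeExtension.

(** * Bounded complete trajectories of the dual semigroup *)

Section Trajectories.
Context {R : realType} {E : normedModType R} (L : banach_lattice E).
Variables (S : R -> E -> E) (M : R).
Hypotheses (M1 : 1 <= M)
  (SL : forall t, 0 < t -> forall (a : R) x y, S t (a *: x + y) = a *: S t x + S t y)
  (SD : forall s t, 0 < s -> 0 < t -> forall f, S (s + t) f = S t (S s f))
  (SM : forall t, 0 < t -> forall f, `|S t f| <= M * `|f|)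
  (Spos : sg_positive L S).
Local Notation pos := (bl_pos L).
Implicit Types (X Y Z V W : R -> E -> R) (r t : R) (f g : E).

Lemma sg_addD t x y : 0 < t -> S t (x + y) = S t x + S t y.
Proof. by move=> t0; have := SL t0 1 x y; rewrite !scale1r. Qed.

Lemma sg_add0 t : 0 < t -> S t 0 = 0.
Proof.
by move=> t0; apply: (addrI (S t 0)); rewrite -sg_addD// !addr0.
Qed.

Lemma sg_addZ t (a : R) x : 0 < t -> S t (a *: x) = a *: S t x.
Proof. by move=> t0; have := SL t0 a x 0; rewrite sg_add0// !addr0. Qed.

Lemma sg_addB t x y : 0 < t -> S t (x - y) = S t x - S t y.
Proof. by move=> t0; rewrite sg_addD// -scaleN1r sg_addZ// scaleN1r. Qed.

Lemma sg_le t x y : 0 < t -> pos (y - x) -> pos (S t y - S t x).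
Proof. by move=> t0 yx; rewrite -sg_addB//; exact: Spos. Qed.

Definition tbounded (c : R) X := forall r f, `|X r f| <= c * `|f|.

Definition traj X :=
  [/\ forall r, lin_form (X r), exists c, tbounded c X &
      forall r t f, 0 < t -> X (r + t) (S t f) = X r f].

Definition tpos X := forall r f, pos f -> 0 <= X r f.
Definition tle X Y := forall r f, pos f -> X r f <= Y r f.

Lemma traj_bounded X : traj X -> exists2 c, 0 <= c & tbounded c X.
Proof.
move=> [_ [c Xc] _]; exists `|c| => // r f.
by apply: le_trans (Xc r f) _; rewrite ler_wpM2r// ler_norm.
Qed.

Lemma traj_comb (a b : R) X Y : traj X -> traj Y ->
  traj (fun r f => a * X r f + b * Y r f).
Proof.
move=> trX trY; have [c c0 Xc] := traj_bounded trX; have [d d0 Yd] := traj_bounded trY.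
case: trX trY => [XL _ XE] [YL _ YE]; split=> [r k x y||r t f t0].
- by rewrite XL YL; ring.
- exists (`|a| * c + `|b| * d) => r f; apply: le_trans (ler_normD _ _) _.
  by rewrite !normrM mulrDl lerD// -mulrA ler_wpM2l.
- by rewrite XE// YE.
Qed.

Lemma traj_sub X Y : traj X -> traj Y -> traj (fun r f => X r f - Y r f).
Proof.
move=> trX trY; have := traj_comb 1 (-1) trX trY; congr traj.
by apply/funext => r; apply/funext => f; rewrite mul1r mulN1r.
Qed.

Lemma traj_shift h X : traj X -> traj (fun r f => X (r + h) f).
Proof.
move=> [XL [c Xc] XE]; split=> [r||r t f t0]; first exact: XL.
  by exists c => r f; exact: Xc.
by rewrite addrAC XE.
Qed.

Lemma traj_eq0 X : traj X -> (forall r f, pos f -> X r f = 0) -> forall r f, X r f = 0.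
Proof.
move=> [XL _ _] h r f; rewrite (pospart_decomp L f) lin_formB//.
by rewrite !h ?subrr//; exact: pospart_pos.
Qed.

(** At a fixed [t] the supremum over [g] is the positive part of [X (r + t)] evaluated at [S t f].
    It increases with [t], and taking the supremum over all [t] restores the trajectory identity. *)
Definition tvals X r f : set R :=
  [set y | exists t g, [/\ 0 < t, pos g, pos (S t f - g) & y = X (r + t) g]].

(** Replacing [g] by [S (t - t0) g] carries a value to any later time, so that two values can be
    compared at a common time. *)
Lemma tvals_later X r f y : traj X -> tvals X r f y ->
  exists2 t0, 0 < t0 & forall t, t0 < t ->
    exists g, [/\ pos g, pos (S t f - g) & y = X (r + t) g].
Proof.
move=> [_ _ XE] [t0 [g [t00 g0 gf ->]]]; exists t0 => // t t0t.
have d0 : 0 < t - t0 by rewrite subr_gt0.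
have tE : t = t0 + (t - t0) by rewrite addrC subrK.
exists (S (t - t0) g); split; first exact: Spos.
- by have := SD t00 d0 f; rewrite -tE => ->; exact: sg_le.
- by have := XE (r + t0) (t - t0) g d0; rewrite -addrA -tE.
Qed.

Lemma traj_pospart X c : traj X -> 0 <= c -> tbounded c X ->
  exists P, [/\ traj P, tbounded (c * M) P, tpos P, tle X P &
    forall Q, traj Q -> tpos Q -> tle X Q -> tle P Q].
Proof.
move=> trX c0 Xc; have [XL _ XE] := trX.
have M0 : 0 <= M by apply: le_trans M1.
pose s r f := sup (tvals X r f).
have v0 r f : pos f -> tvals X r f 0.
  move=> f0; exists 1, 0; split=> //; first exact: bl_pos0.
    by rewrite subr0; exact: Spos.
  by rewrite lin_form0.
(* The factor [M] enters because [g] lies below [S t f]. *)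
have vub r f : pos f -> ubound (tvals X r f) (c * M * `|f|).
  move=> f0 _ [t [g [t0 g0 gf ->]]]; apply: le_trans (ler_norm _) _.
  apply: le_trans (Xc _ _) _; rewrite -mulrA ler_wpM2l//.
  exact: le_trans (bl_norm_le g0 gf) (SM t0 f).
have les r f y : pos f -> tvals X r f y -> y <= s r f.
  by move=> f0 vy; apply: ub_le_sup => //; exists (c * M * `|f|); exact: vub.
have sle r f b : pos f -> ubound (tvals X r f) b -> s r f <= b.
  by move=> f0; apply: ge_sup; exists 0; exact: v0.
have sZle r f (a : R) : 0 < a -> pos f -> a * s r f <= s r (a *: f).
  move=> a0 f0; rewrite -ler_pdivlMl//; apply: sle => // y [t [g [t0 g0 gf ->]]].
  rewrite ler_pdivlMl//; apply: les; first exact: bl_posZ (ltW a0) f0.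
  exists t, (a *: g); split=> //; first exact: bl_posZ (ltW a0) g0.
    by rewrite sg_addZ// -scalerBr; exact: bl_posZ (ltW a0) gf.
  by rewrite lin_formZ.
(* One inequality only relabels time; for the other, values are first moved beyond time [t]. *)
have sE r t f : 0 < t -> pos f -> s (r + t) (S t f) = s r f.
  move=> t0 f0; have Sf0 : pos (S t f) by exact: Spos.
  apply/eqP; rewrite eq_le; apply/andP; split; apply: sle => // y.
    move=> [u [g [u0 g0 gf ->]]]; apply: les => //.
    exists (t + u), g; split=> //; rewrite ?addr_gt0 ?addrA//.
    by rewrite SD.
  move=> /(tvals_later trX)[u u0 hu]; apply: les => //.
  have [|g [g0 gf ->]] := hu (t + u); first by rewrite ltrDr.
  by exists u, g; split; rewrite ?addrA// -SD.
have /choice[P hP] : forall r, exists phi, [/\ lin_form phi,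
    forall x, pos x -> phi x = s r x & forall x, `|phi x| <= c * M * `|x|].
  move=> r; apply: (@cone_extension _ _ L); last exact: mulr_ge0.
  (* Riesz decomposition splits a value at [x + y]; conversely, values at [x] and at [y] are moved
     to the common time [t1 + t2] and added. *)
  - move=> x y x0 y0; have xy0 := bl_posD x0 y0.
    apply/eqP; rewrite eq_le; apply/andP; split.
      apply: sle => // _ [t [g [t0 g0 gf ->]]]; rewrite sg_addD// in gf.
      have [g1 [g2 [-> g10 g20 g1x g2y]]] :=
        riesz_decomposition (Spos t0 x0) (Spos t0 y0) g0 gf.
      by rewrite (lin_formD (XL _)) lerD//; apply: les => //; [exists t, g1|exists t, g2].
    rewrite -lerBrDr; apply: (sle) => // y1 /(tvals_later trX)[t1 t10 h1].
    rewrite lerBrDl -lerBrDr; apply: (sle) => // y2 /(tvals_later trX)[t2 t20 h2].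
    rewrite lerBrDl; apply: (les) => //.
    have [|g1 [g10 g1x ->]] := h1 (t1 + t2); first by rewrite ltrDl.
    have [|g2 [g20 g2y ->]] := h2 (t1 + t2); first by rewrite ltrDr.
    exists (t1 + t2), (g1 + g2); split; rewrite ?addr_gt0//.
    + exact: bl_posD.
    + rewrite sg_addD ?addr_gt0// opprD addrACA; exact: bl_posD.
    + by rewrite (lin_formD (XL _)).
  - move=> a x a0 x0; apply/eqP; rewrite eq_le sZle// andbT.
    rewrite -ler_pdivrMl//; have aV0 : 0 < a^-1 by rewrite invr_gt0.
    apply: le_trans (sZle _ _ _ aV0 (bl_posZ (ltW a0) x0)) _.
    by rewrite scalerA mulVf ?gt_eqF// scale1r.
  - move=> x x0; apply/andP; split; first by apply: les (v0 _ _ x0).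
    by apply: sle (vub _ _ x0).
have PL r : lin_form (P r) by have [] := hP r.
have Ps r f : pos f -> P r f = s r f by have [_ + _] := hP r; apply.
exists P; split.
- split=> //; first by exists (c * M) => r f; have [_ _] := hP r; apply.
  move=> r t f t0; rewrite (pospart_decomp L f) sg_addB// !lin_formB//.
  by rewrite !Ps ?sE//; do ?apply: Spos => //; exact: pospart_pos.
- by move=> r f; have [_ _] := hP r; apply.
- by move=> r f f0; rewrite Ps//; apply: les (v0 _ _ f0).
- move=> r f f0; rewrite Ps//; apply: les => //.
  exists 1, (S 1 f); split=> //; first exact: Spos.
    by rewrite subrr; exact: bl_pos0.
  by rewrite XE.
(* Minimality: [X (r + t) g <= Q (r + t) g <= Q (r + t) (S t f) = Q r f]. *)
- move=> Q [QL _ QE] Q0 XQ r f f0; rewrite Ps//; apply: sle => // _ [t [g [t0 g0 gf ->]]].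
  apply: le_trans (XQ _ _ g0) _; rewrite -(QE r t f)// -subr_ge0 -lin_formB//.
  exact: Q0.
Qed.

(** The meet of [V] and [Z] being zero, tested on trajectories. *)
Definition tdisj V Z := forall W, traj W -> tpos W -> tle W V -> tle W Z ->
  forall r f, W r f = 0.

(** * Trajectories under a small shift *)

Section Shift.
Variables (h : R).
(** The [M] in the divisor cancels the factor produced by [traj_pospart]; the 2 then leaves a
    contraction. *)
Hypothesis (h0 : 0 < h)
  (close : forall X c, traj X -> 0 <= c -> tbounded c X ->
    tbounded (c / (2 * M)) (fun r f => X (r + h) f - X r f)).

(* If [W <= V] and [W <= shift Z], then [W] and its shift are disjoint, so [W]
   is the positive part of their difference and its norm is at most half itself. *)
Lemma tdisj_shift V Z (a : R) : 0 <= a <= 1 -> traj Z -> tpos Z -> tdisj V Z ->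
  tdisj V (fun r f => a * Z (r - h) f).
Proof.
move=> /andP[a0 a1] trZ Z0 VZ W trW W0 WV WZ.
have M0 : 0 < M by apply: lt_le_trans M1.
pose W' r f := W (r + h) f.
have trW' : traj W' by exact: traj_shift.
have WZ' : tle W' Z.
  move=> r f f0; apply: le_trans (WZ _ _ f0) _; rewrite addrK.
  by apply: ler_piMl => //; exact: Z0.
have half c : 0 <= c -> tbounded c W -> tbounded (c / 2) W.
  move=> c0 Wc.
  have bd : tbounded (c / (2 * M)) (fun r f => W r f - W' r f).
    by move=> r f; rewrite distrC; apply: close.
  have c20 : 0 <= c / (2 * M) by rewrite divr_ge0// mulr_ge0// ltW.
  have [P [trP Pb P0 WP Pl]] := traj_pospart (traj_sub trW trW') c20 bd.
  have PW : tle P W.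
    apply: Pl => // r f f0; have := W0 (r + h) f f0; rewrite /W'; lra.
  (* [W - P] is the meet of [W] and its shift [W'], hence lies below both [V] and [Z]. *)
  have E0 : forall r f, W r f - P r f = 0.
    apply: VZ; first exact: traj_sub.
    - by move=> r f f0; rewrite subr_ge0; exact: PW.
    - move=> r f f0; have := P0 r f f0; have := WV r f f0; lra.
    - move=> r f f0; have := WP r f f0; have := WZ' r f f0; lra.
  move=> r f; have := Pb r f; have /eqP := E0 r f; rewrite subr_eq0 => /eqP ->.
  by rewrite invfM mulrA mulfVK ?gt_eqF.
have [c c0 Wc] := traj_bounded trW.
have Wn n : tbounded (c / 2 ^+ n) W.
  elim: n => [|n IH]; first by rewrite expr0 divr1.
  rewrite exprSr invfM mulrA; apply: half => //.
  by rewrite divr_ge0// exprn_ge0.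
move=> r f; apply/eqP; rewrite -normr_eq0 eq_le normr_ge0 andbT.
apply: (@geometric_le0 _ 2^-1 (c * `|f|)); first by lra.
by move=> n; have := Wn n r f; rewrite exprVn mulrAC.
Qed.

Lemma traj_shift_le X : traj X -> tpos X -> tle (fun r f => X (r - h) f) X.
Proof.
move=> trX X0.
suff main lam : 0 < lam < 1 -> tle (fun r f => lam * X (r - h) f) X.
  move=> r f f0; rewrite leNgt; apply/negP => xy.
  have x0 := X0 r f f0; set x := X r f in x0 xy; set y := X (r - h) f in xy.
  have y0 : 0 < y by exact: le_lt_trans xy.
  (* As [x < y], this factor lies in (0, 1), and it would put the midpoint of [x] and [y] below
     [x]. *)
  have := @main ((x + y) / (2 * y)) _ r f f0.
  have -> : (x + y) / (2 * y) * X (r - h) f = (x + y) / 2.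
    by rewrite -/y; field; rewrite gt_eqF.
  rewrite -/x => H; suff : (x + y) / 2 <= x by lra.
  apply: H; rewrite divr_gt0 ?mulr_gt0//; last by lra.
  by rewrite ltr_pdivrMr ?mulr_gt0//; lra.
move=> /andP[l0 l1].
have trT n Y : traj Y -> traj (fun r f => lam ^+ n * Y (r - n%:R * h) f).
  move=> trY; have trS := traj_shift (- (n%:R * h)) trY.
  have := traj_comb (lam ^+ n) 0 trS trS; congr traj.
  by apply/funext => r; apply/funext => f; rewrite mul0r addr0.
have T0 n Y : tpos Y -> tpos (fun r f => lam ^+ n * Y (r - n%:R * h) f).
  by move=> Y0 r f f0; rewrite mulr_ge0 ?exprn_ge0 ?(ltW l0)//; exact: Y0.
have trTX : traj (fun r f => lam * X (r - h) f).
  by have := trT 1%N X trX; congr traj;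
    apply/funext => r; apply/funext => f; rewrite expr1 mul1r.
have TX0 : tpos (fun r f => lam * X (r - h) f).
  by move=> r f f0; rewrite mulr_ge0 ?(ltW l0)//; exact: X0.
have trD := traj_sub trX trTX; have [d d0 Dd] := traj_bounded trD.
have [Z [trZ _ Z0 DZ Zl]] := traj_pospart trD d0 Dd.
have ZX : tle Z X by apply: Zl => // r f f0; have := TX0 r f f0; lra.
(* [Z] and [V] are the positive and negative parts of [X - T X], where [T] is [lam] times the shift
   by [- h]. *)
pose V r f := Z r f - (X r f - lam * X (r - h) f).
have trV : traj V by exact: traj_sub.
have V0 : tpos V by move=> r f f0; rewrite subr_ge0; exact: DZ.
(* A common lower bound [W] can be subtracted from [Z] without leaving the positive majorants of
   [X - T X], so [Z <= Z - W]. *)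
have VZ : tdisj V Z.
  move=> W trW W0 WV WZ; apply: traj_eq0 => // r f f0.
  apply/eqP; rewrite eq_le W0// andbT.
  suff : Z r f <= Z r f - W r f by lra.
  apply: (Zl (fun r f => Z r f - W r f)) => //; first exact: traj_sub.
    by move=> r' f' f'0; rewrite subr_ge0; exact: WZ.
  by move=> r' f' f'0; have := WV r' f' f'0; rewrite /V; lra.
have VTZ n : tdisj V (fun r f => lam ^+ n * Z (r - n%:R * h) f).
  elim: n => [|n IH].
    move: VZ; congr tdisj; apply/funext => r; apply/funext => f.
    by rewrite expr0 mul1r mul0r subr0.
  have l01 : 0 <= lam <= 1 by rewrite !ltW.
  have := tdisj_shift l01 (trT n _ trZ) (T0 n _ Z0) IH; congr tdisj.
  apply/funext => r; apply/funext => f; rewrite mulrA -exprS -addrA -opprD.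
  by rewrite -natr1 mulrDl mul1r [h + _]addrC.
(* Inductively [V <= T^(n+1) X <= T^(n+2) X + T^(n+1) Z]. The positive part of [V - T^(n+2) X] lies
   below the disjoint [V] and [T^(n+1) Z], so it vanishes. *)
have VT n : tle V (fun r f => lam ^+ n.+1 * X (r - n.+1%:R * h) f).
  elim: n => [|n IH].
    move=> r f f0; rewrite expr1 mul1r /V; have := ZX r f f0; lra.
  pose a r f := lam ^+ n.+2 * X (r - n.+2%:R * h) f.
  pose b r f := lam ^+ n.+1 * Z (r - n.+1%:R * h) f.
  have a0 : tpos a by exact: T0.
  have tra : traj a by exact: trT.
  have Vab r f : pos f -> V r f <= a r f + b r f.
    move=> f0; apply: le_trans (IH r f f0) _.
    have := DZ (r - n.+1%:R * h) f f0.
    have -> : r - n.+1%:R * h - h = r - n.+2%:R * h.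
      by rewrite -[n.+2%:R]natr1; ring.
    move=> hh; rewrite /a /b [_ ^+ n.+2]exprSr -mulrA -mulrDr ler_wpM2l ?exprn_ge0 ?(ltW l0)//.
    lra.
  have trVa := traj_sub trV tra; have [e e0 Ve] := traj_bounded trVa.
  have [Q [trQ _ Q0 VQ Ql]] := traj_pospart trVa e0 Ve.
  have QE : forall r f, Q r f = 0.
    apply: (VTZ n.+1) => //.
      by apply: Ql => // r f f0; have := a0 r f f0; lra.
    apply: Ql; [exact: trT|exact: T0|].
    by move=> r f f0; have := Vab r f f0; rewrite /b; lra.
  by move=> r f f0; have := VQ r f f0; rewrite QE /a; lra.
have [c c0 Xc] := traj_bounded trX.
have V_le0 r f : pos f -> V r f <= 0.
  move=> f0; apply: (@geometric_le0 _ lam (lam * (c * `|f|))); first by rewrite (ltW l0).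
  move=> n; apply: le_trans (VT n r f f0) _.
  rewrite exprS mulrAC ler_wpM2r ?exprn_ge0 ?(ltW l0)//.
  by rewrite ler_wpM2l ?(ltW l0)//; apply: le_trans (ler_norm _) (Xc _ _).
move=> r f f0; have := V_le0 r f f0; have := Z0 r f f0; rewrite /V; lra.
Qed.

(** For a positive trajectory the increment [D] is positive, hence itself nondecreasing under the
    shift, and [n] copies of it lie below a bounded telescoping difference. A general trajectory is
    a difference of two positive ones. *)
Lemma traj_shift_const X : traj X -> forall r f, X (r + h) f = X r f.
Proof.
have pconst Y : traj Y -> tpos Y -> forall r f, Y (r + h) f - Y r f = 0.
  move=> trY Y0; pose D r f := Y (r + h) f - Y r f.
  have trD : traj D by apply: traj_sub => //; exact: traj_shift.
  have D0 : tpos D.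
    by move=> r f f0; have := traj_shift_le trY Y0 (r + h) f0; rewrite addrK /D; lra.
  apply: traj_eq0 => // r f f0; apply/eqP; rewrite eq_le D0// andbT.
  have Dn n : D r f <= D (r + n%:R * h) f.
    elim: n => [|n IH]; first by rewrite mul0r addr0.
    apply: le_trans IH _; have := traj_shift_le trD D0 (r + n.+1%:R * h) f0.
    by congr (D _ f <= _); rewrite -natr1; ring.
  have Yn n : n%:R * D r f <= Y (r + n%:R * h) f - Y r f.
    elim: n => [|n IH]; first by rewrite !mul0r addr0 subrr.
    have := Dn n; rewrite /D => hn.
    have -> : r + n.+1%:R * h = r + n%:R * h + h by rewrite -natr1; ring.
    by rewrite -natr1 mulrDl mul1r /D in IH *; lra.
  have [c c0 Yc] := traj_bounded trY.
  apply: (@natmul_le0 _ _ (c * `|f| + c * `|f|)) => n.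
  apply: le_trans (Yn n) _; apply: le_trans (ler_norm _) _.
  by apply: le_trans (ler_normB _ _) _; exact: lerD.
move=> trX r f; have [c c0 Xc] := traj_bounded trX.
have [P [trP _ P0 XP _]] := traj_pospart trX c0 Xc.
have h1 := pconst P trP P0 r f.
have h2 : P (r + h) f - X (r + h) f - (P r f - X r f) = 0.
  apply: (pconst (fun r f => P r f - X r f)); first exact: traj_sub.
  by move=> r' f' f'0; rewrite subr_ge0; exact: XP.
lra.
Qed.

End Shift.

Hypothesis enc : eventually_norm_continuous S.

Lemma traj_const X : traj X -> forall r t f, 0 < t -> X (r + t) f = X r f.
Proof.
move=> trX; have M0 : 0 < M by apply: lt_le_trans M1.
case: enc => t0 [t00 ct]; have t01 : t0 < t0 + 1 by rewrite ltrDl.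
have eM0 : 0 < (2 * M)^-1 by rewrite invr_gt0 mulr_gt0.
have [d [d0 cd]] := ct _ t01 _ eM0.
have hsmall h : 0 < h -> h < d -> forall r f, X (r + h) f = X r f.
  move=> h0 hd; apply: traj_shift_const => // Y c [YL _ YE] c0 Yc r f.
  have p1 : 0 < t0 + 1 by lra.
  have p2 : 0 < t0 + 1 + h by lra.
  (* Both values are carried to time [r + (t0 + 1 + h)]: a single functional is applied to
     [S (t0 + 1) f - S (t0 + 1 + h) f], which norm continuity controls. *)
  rewrite -(YE r _ f p2) -(YE (r + h) _ f p1).
  have -> : r + h + (t0 + 1) = r + (t0 + 1 + h) by ring.
  rewrite -lin_formB//; apply: le_trans (Yc _ _) _.
  rewrite -mulrA ler_wpM2l// distrC; apply: cd; first by lra.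
  by rewrite addrAC subrr add0r gtr0_norm.
move=> r t f tp.
(* An arbitrary [t] is cut into [n] steps shorter than [d]. *)
pose n := (Num.truncn (t / d)).+1.
have n0 : 0 < n%:R :> R by rewrite ltr0n.
have hn : 0 < t / n%:R by rewrite divr_gt0.
have hnd : t / n%:R < d.
  by rewrite ltr_pdivrMr// mulrC -ltr_pdivrMr//; exact: truncnS_gt.
have it k : X (r + k%:R * (t / n%:R)) f = X r f.
  elim: k => [|k IH]; first by rewrite mul0r addr0.
  by rewrite -natr1 mulrDl mul1r addrA hsmall.
by have := it n; rewrite mulrCA divff ?gt_eqF// mulr1.
Qed.

Lemma traj_invariant X : traj X -> forall r t f, 0 < t -> X r (S t f) = X r f.
Proof.
move=> trX r t f t0; rewrite -(traj_const trX r _ t0).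
by have [_ _] := trX; apply.
Qed.

End Trajectories.

(** * The kernels of the generator and of its dual *)

Section Limits.
Context {R : realType} {E : normedModType R}.

Lemma cvg_right0_normP (u : R -> E) (l : E) : u @ 0^'+ --> l <->
  forall e : R, 0 < e -> exists2 d, 0 < d & forall t, 0 < t < d -> `|l - u t| <= e.
Proof.
split=> [/cvgrPdist_le ul e e0|ul].
  have /nbhs_ballP[d /= d0 hd] := ul e e0.
  exists d => // t /andP[t0 td]; apply: hd => //=.
  by rewrite /ball/= sub0r normrN gtr0_norm.
apply/cvgrPdist_le => e e0; have [d d0 hd] := ul e e0.
apply/nbhs_ballP; exists d => //= t; rewrite /ball/= sub0r normrN => td t0.
by apply: hd; rewrite t0/=; apply: le_lt_trans td; rewrite ler_norm.
Qed.

Lemma cvg_pinfty_normP (u : R -> E) (l : E) : u @ +oo --> l <->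
  forall e : R, 0 < e -> exists A, forall t, A < t -> `|l - u t| <= e.
Proof.
split=> [/cvgrPdist_le ul e e0|ul].
  by have [A [_ hA]] := ul e e0; exists A.
apply/cvgrPdist_le => e e0; have [A hA] := ul e e0.
by exists A; split => //; exact: num_real.
Qed.

Lemma norm_le_eps (x : E) (C : R) :
  0 <= C -> (forall e, 0 < e -> `|x| <= C * e) -> x = 0.
Proof.
move=> C0 xe; apply/eqP; rewrite -normr_eq0 eq_le normr_ge0 andbT.
have C1 : 0 < C + 1 by lra.
apply/ler_addgt0Pr => e e0; rewrite add0r.
apply: le_trans (xe (e / (C + 1)) _) _; first by rewrite divr_gt0.
by rewrite mulrCA ger_pMr// ler_pdivrMr//; lra.
Qed.

End Limits.

Section Generator.
Context {R : realType} {E : completeNormedModType R}.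
Variables (S : R -> E -> E) (M : R).
Hypotheses (M1 : 1 <= M)
  (SL : forall t, 0 < t -> forall (a : R) x y, S t (a *: x + y) = a *: S t x + S t y)
  (SD : forall s t, 0 < s -> 0 < t -> forall f, S (s + t) f = S t (S s f))
  (SM : forall t, 0 < t -> forall f, `|S t f| <= M * `|f|)
  (S0 : forall f, S^~ f @ 0^'+ --> f).

(** Values of [S] at nonpositive times are arbitrary. Putting the identity there lets Riemann sums
    start at time 0 and continuity at 0 be stated by an upper bound on time alone. *)
Definition sg0 (t : R) (f : E) : E := if 0 < t then S t f else f.

Lemma sg0_gt0 t f : 0 < t -> sg0 t f = S t f.
Proof. by rewrite /sg0 => ->. Qed.

Lemma sg0_le0 t f : t <= 0 -> sg0 t f = f.
Proof. by rewrite /sg0 ltNge => ->. Qed.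

Lemma sg0D s t f : 0 <= s -> 0 <= t -> sg0 (s + t) f = sg0 s (sg0 t f).
Proof.
rewrite le_eqVlt => /predU1P[<-|s0]; first by rewrite add0r (@sg0_le0 0).
rewrite le_eqVlt => /predU1P[<-|t0]; first by rewrite addr0 (@sg0_le0 0).
by rewrite !sg0_gt0 ?addr_gt0// addrC SD.
Qed.

Lemma sg0_norm t f : `|sg0 t f| <= M * `|f|.
Proof.
by rewrite /sg0; case: ifP => t0; [exact: SM|exact: ler_peMl].
Qed.

Lemma sg0_add t x y : sg0 t (x + y) = sg0 t x + sg0 t y.
Proof. by rewrite /sg0; case: ifP => // t0; exact: sg_addD. Qed.

Lemma sg0_scale t (a : R) x : sg0 t (a *: x) = a *: sg0 t x.
Proof. by rewrite /sg0; case: ifP => // t0; exact: sg_addZ. Qed.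

Lemma sg0_sub t x y : sg0 t (x - y) = sg0 t x - sg0 t y.
Proof. by rewrite sg0_add -scaleN1r sg0_scale scaleN1r. Qed.

Lemma sg0_cont f (e : R) : 0 < e ->
  exists2 d, 0 < d & forall t, t < d -> `|sg0 t f - f| <= e.
Proof.
move=> e0; have /cvg_right0_normP/(_ e e0)[d d0 hd] := @S0 f; exists d => // t td.
have [t0|t0] := ltP 0 t; last by rewrite sg0_le0// subrr normr0 ltW.
by rewrite sg0_gt0// distrC; apply: hd; rewrite t0.
Qed.

(** With [[0, t]] cut into short steps of length [s], one step moves [f] by at most [e * s], and
    transporting this along the orbit costs a factor [M]; the total is at most [t * M * e]. *)
Lemma generator_ker_fixed f : generator S f 0 -> forall t, 0 < t -> S t f = f.
Proof.
move=> /cvg_right0_normP Sf t t0; apply/eqP; rewrite -subr_eq0; apply/eqP.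
have M0 : 0 <= M by apply: le_trans M1.
apply: (@norm_le_eps _ _ _ (t * M)); first by rewrite mulr_ge0// ltW.
move=> e e0; have [d d0 hd] := Sf e e0.
pose n := (Num.truncn (t / d)).+1.
have n0 : 0 < n%:R :> R by rewrite ltr0n.
pose s := t / n%:R; have s0 : 0 < s by rewrite divr_gt0.
have sd : s < d.
  by rewrite ltr_pdivrMr// mulrC -ltr_pdivrMr//; exact: truncnS_gt.
have hs : `|S s f - f| <= e * s.
  have := hd s; rewrite s0 sd => /(_ isT).
  rewrite sub0r normrN normrZ gtr0_norm ?invr_gt0//.
  by rewrite mulrC ler_pdivrMr.
have it k : `|sg0 (k%:R * s) f - f| <= k%:R * (M * (e * s)).
  elim: k => [|k IH]; first by rewrite !mul0r sg0_le0// subrr normr0.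
  have -> : k.+1%:R * s = k%:R * s + s by rewrite -natr1 mulrDl mul1r.
  have ks0 : 0 <= k%:R * s by rewrite mulr_ge0// ltW.
  rewrite (sg0D _ ks0 (ltW s0)) [sg0 s f]sg0_gt0//.
  have -> : sg0 (k%:R * s) (S s f) - f =
      sg0 (k%:R * s) (S s f - f) + (sg0 (k%:R * s) f - f).
    by rewrite sg0_sub addrA subrK.
  apply: le_trans (ler_normD _ _) _; rewrite -natr1 mulrDl mul1r addrC lerD//.
  by apply: le_trans (sg0_norm _ _) _; rewrite ler_wpM2l.
have ns : n%:R * s = t by rewrite /s mulrCA divff ?gt_eqF// mulr1.
have := it n; rewrite ns sg0_gt0// => /le_trans; apply.
by rewrite le_eqVlt; apply/orP; left; apply/eqP; rewrite -ns; ring.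
Qed.

(** * Orbit integrals as limits of Riemann sums *)

Section Cocycle.
Variable f : E.

(** Left Riemann sum of the orbit of [f] over [[0, m d]] with mesh [d]. *)
Definition rsum (d : R) (m : nat) : E := \sum_(k < m) d *: sg0 (k%:R * d) f.

Lemma rsumD d m n : 0 <= d -> rsum d (m + n) = rsum d m + sg0 (m%:R * d) (rsum d n).
Proof.
move=> d0; elim: n => [|n IH].
  rewrite addn0 /rsum big_ord0 -[X in sg0 _ X](scale0r 0) sg0_scale scale0r.
  by rewrite addr0.
rewrite addnS /rsum big_ord_recr/= -/(rsum _ _) IH [in RHS]big_ord_recr/=.
rewrite -/(rsum _ _) sg0_add addrA sg0_scale -sg0D ?mulr_ge0//.
by rewrite natrD mulrDl.
Qed.

Lemma rsum_approx d m (e : R) : 0 <= d ->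
  (forall t, t <= m%:R * d -> `|sg0 t f - f| <= e) ->
  `|rsum d m - (m%:R * d) *: f| <= m%:R * d * e.
Proof.
move=> d0 he; have -> : (m%:R * d) *: f = \sum_(k < m) d *: f.
  by rewrite sumr_const card_ord scalerMnl mulr_natl.
rewrite -sumrB; apply: le_trans (ler_norm_sum _ _ _) _.
have -> : m%:R * d * e = \sum_(k < m) d * e.
  by rewrite sumr_const card_ord -mulrA mulr_natl.
apply: ler_sum => k _; rewrite -scalerBr normrZ ger0_norm// ler_wpM2l//.
by apply: he; rewrite ler_wpM2r// ler_nat ltnW.
Qed.

Lemma rsum_norm d m : 0 <= d -> `|rsum d m| <= m%:R * d * (M * `|f|).
Proof.
move=> d0; apply: le_trans (ler_norm_sum _ _ _) _.
have -> : m%:R * d * (M * `|f|) = \sum_(k < m) d * (M * `|f|).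
  by rewrite sumr_const card_ord -mulrA mulr_natl.
apply: ler_sum => k _; rewrite normrZ ger0_norm// ler_wpM2l//.
exact: sg0_norm.
Qed.

(** The error on the block starting at [k q d] is [S (k q d)] applied to the error on the first
    block, which [rsum_approx] bounds. *)
Lemma rsum_refine d q m (e : R) : 0 <= d ->
  (forall t, t <= q%:R * d -> `|sg0 t f - f| <= e) ->
  `|rsum d (m * q) - rsum (q%:R * d) m| <= m%:R * (q%:R * d) * (M * e).
Proof.
move=> d0 he; have M0 : 0 <= M by apply: le_trans M1.
elim: m => [|m IH].
  by rewrite mul0n /rsum !big_ord0 subrr normr0 !mul0r.
rewrite mulSnr rsumD// [rsum (_ * _) m.+1]/rsum big_ord_recr/= -/(rsum _ _).
rewrite natrM -mulrA opprD addrACA -sg0_scale -sg0_sub.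
apply: le_trans (ler_normD _ _) _; rewrite -natr1 !mulrDl mul1r lerD//.
apply: le_trans (sg0_norm _ _) _; rewrite mulrCA ler_wpM2l//.
exact: rsum_approx.
Qed.

Definition dyad (n : nat) : R := 2^-1 ^+ n.

Lemma dyad_gt0 n : 0 < dyad n.
Proof. by rewrite exprn_gt0// invr_gt0. Qed.

Lemma dyad_small (e : R) : 0 < e -> exists N, forall n, (N <= n)%N -> dyad n <= e.
Proof.
move=> e0; have h2 : `|2^-1 : R| < 1 by rewrite ger0_norm; lra.
have /cvgrPdist_le/(_ e e0)[N _ hN] := cvg_geometric 1 h2.
by exists N => n Nn; have := hN n Nn; rewrite /= sub0r normrN mul1r ger0_norm.
Qed.

Definition dyadn n (t : R) : nat := Num.truncn (t / dyad n).

Lemma dyadn_itv n t : 0 <= t ->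
  (dyadn n t)%:R * dyad n <= t < (dyadn n t)%:R * dyad n + dyad n.
Proof.
move=> t0; have d0 := dyad_gt0 n.
have := @truncn_itv R (t / dyad n); rewrite divr_ge0 ?(ltW d0)// => /(_ isT).
by rewrite ler_pdivlMr// ltr_pdivrMr// -natr1 mulrDl mul1r.
Qed.

Lemma dyadn_le n t (m : nat) : 0 <= t -> m%:R * dyad n <= t -> (m <= dyadn n t)%N.
Proof.
move=> t0 mt; have d0 := dyad_gt0 n.
by rewrite truncn_ge_nat ?divr_ge0 ?(ltW d0)// ler_pdivlMr.
Qed.

Lemma dyadn_ge n t (m : nat) : 0 <= t -> t < m%:R * dyad n -> (dyadn n t < m)%N.
Proof.
move=> t0 mt; have d0 := dyad_gt0 n.
by rewrite truncn_lt_nat ?divr_ge0 ?(ltW d0)// ltr_pdivrMr.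
Qed.

Definition rint n t : E := rsum (dyad n) (dyadn n t).

(** The first term compares meshes on the full coarse cells of [[0, t]]; the second bounds the fine
    cells left over, which fill at most one coarse cell. *)
Lemma rint_cauchy n p t (e : R) : 0 <= t ->
  (forall s, s <= dyad n -> `|sg0 s f - f| <= e) ->
  `|rint (n + p) t - rint n t| <= t * (M * e) + M * (dyad n * (M * `|f|)).
Proof.
move=> t0 he; have M0 : 0 <= M by apply: le_trans M1.
have e0 : 0 <= e.
  by apply: le_trans (normr_ge0 _) (he 0 _); exact: ltW (dyad_gt0 n).
have dnp : dyad n = (2 ^ p)%:R * dyad (n + p).
  by rewrite /dyad exprD mulrCA natrX -exprMn divff// expr1n mulr1.
set d' := dyad (n + p); have d'0 : 0 < d' by exact: dyad_gt0.
have /andP[m1 m2] := dyadn_itv n t0; rewrite /rint; set m := dyadn n t in m1 m2 *.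
have le1 : (m * 2 ^ p <= dyadn (n + p) t)%N.
  by apply: dyadn_le => //; rewrite natrM -mulrA -dnp.
have le2 : (dyadn (n + p) t < m.+1 * 2 ^ p)%N.
  by apply: dyadn_ge => //; rewrite natrM -mulrA -dnp -natr1 mulrDl mul1r.
rewrite -(subnKC le1); set j := (_ - _)%N.
have jp : (j <= 2 ^ p)%N by rewrite leq_subLR -mulSnr ltnW.
rewrite rsumD ?(ltW d'0)// addrAC; apply: le_trans (ler_normD _ _) _; apply: lerD.
  rewrite dnp; apply: le_trans (rsum_refine _ (ltW d'0) _) _.
    by rewrite -/d' -dnp; exact: he.
  by rewrite -/d' -dnp ler_wpM2r// mulr_ge0.
apply: le_trans (sg0_norm _ _) _; rewrite ler_wpM2l//.
apply: le_trans (rsum_norm _ (ltW d'0)) _; rewrite ler_wpM2r ?mulr_ge0//.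
by rewrite dnp ler_wpM2r ?(ltW d'0)// ler_nat.
Qed.

Lemma rint_cvg t : 0 <= t -> cvg (rint n t @[n --> \oo]).
Proof.
move=> t0; apply: cauchy_cvg; apply: cauchy_exP => e e0.
have M0 : 0 <= M by apply: le_trans M1.
(* The coefficients of the two errors sum to [C - 1]; the extra 1 makes [C] positive and the
   estimate strict. *)
pose C := t * M + M * (M * `|f|) + 1.
have C0 : 0 < C by rewrite ltr_pwDr// addr_ge0// ?mulr_ge0// mulr_ge0.
have eC0 : 0 < e / (C + C) by rewrite divr_gt0// addr_gt0.
have [d d0 hd] := @sg0_cont f _ eC0.
have [N hN] : exists N, dyad N <= e / (C + C) /\ dyad N < d.
  have m0 : 0 < Num.min (e / (C + C)) (d / 2) by rewrite lt_min eC0 divr_gt0.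
  have [N /(_ _ (leqnn N))] := dyad_small m0; rewrite le_min => /andP[h1 h2].
  by exists N; split=> //; lra.
exists (rint N t), N => // n /= Nn; rewrite -ball_normE /ball_/= distrC.
rewrite -(subnKC Nn); apply: le_lt_trans (rint_cauchy _ t0 _) _.
  by move=> s sN; apply: hd; apply: le_lt_trans hN.2.
have -> : t * (M * (e / (C + C))) + M * (dyad N * (M * `|f|)) =
   (t * M) * (e / (C + C)) + (M * (M * `|f|)) * dyad N by ring.
apply: (@le_lt_trans _ _ ((C - 1) * (e / (C + C)))).
  have -> : C - 1 = t * M + M * (M * `|f|) by rewrite /C; ring.
  by rewrite mulrDl lerD// ler_wpM2l ?mulr_ge0//; exact: hN.1.
apply: (@lt_le_trans _ _ (C * (e / (C + C)))); first by rewrite ltr_pM2r//; lra.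
have -> : C * (e / (C + C)) = e / 2 by field; rewrite gt_eqF//=; lra.
lra.
Qed.

(* The integral of [s |-> S s f] over [0, t], as a limit of dyadic Riemann sums. *)
Definition sg_int t : E := lim (rint n t @[n --> \oo]).

Lemma sg_intP t (e : R) : 0 <= t -> 0 < e ->
  exists N, forall n, (N <= n)%N -> `|sg_int t - rint n t| <= e.
Proof.
by move=> t0 e0; have /cvgrPdist_le/(_ e e0)[N _ hN] := rint_cvg t0; exists N.
Qed.

Lemma sg_int_approx h (e : R) : 0 <= h ->
  (forall s, s <= h -> `|sg0 s f - f| <= e) -> `|sg_int h - h *: f| <= h * e.
Proof.
move=> h0 he; apply/ler_addgt0Pr => eta eta0.
have e0 : 0 <= e by apply: le_trans (normr_ge0 _) (he 0 _).
have f0 : 0 < `|f| + 1 by rewrite ltr_pwDr.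
have [N hN] := sg_intP h0 (divr_gt0 eta0 (ltr0n R 2)).
have [N' hN'] := dyad_small (divr_gt0 (divr_gt0 eta0 (ltr0n R 2)) f0).
pose n := maxn N N'.
have /andP[m1 m2] := dyadn_itv n h0.
have d0 := dyad_gt0 n.
have h1 := hN n (leq_maxl _ _); have h2 := hN' n (leq_maxr _ _).
have h3 : `|rint n h - ((dyadn n h)%:R * dyad n) *: f| <= h * e.
  apply: le_trans (rsum_approx (ltW d0) (e := e) _) _; last by rewrite ler_wpM2r.
  by move=> s sm; apply: he; apply: le_trans m1.
have h4 : `|((dyadn n h)%:R * dyad n) *: f - h *: f| <= eta / 2.
  rewrite -scalerBl normrZ distrC ger0_norm ?subr_ge0//.
  apply: (@le_trans _ _ (dyad n * (`|f| + 1))); last by rewrite -ler_pdivlMr.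
  by apply: ler_pM; rewrite ?subr_ge0//; lra.
have -> : sg_int h - h *: f = (sg_int h - rint n h) +
  ((rint n h - ((dyadn n h)%:R * dyad n) *: f) +
   (((dyadn n h)%:R * dyad n) *: f - h *: f)).
  by rewrite !addrA !subrK.
apply: le_trans (ler_normD _ _) _.
by have := ler_normD (rint n h - ((dyadn n h)%:R * dyad n) *: f)
   (((dyadn n h)%:R * dyad n) *: f - h *: f); lra.
Qed.

(** The Riemann sum over [[0, t + h]] splits at the grid point [s] below [t]; strong continuity on
    the orbit of [sg_int h] then replaces [s] by [t]. *)
Lemma sg_int_cocycle t h : 0 <= t -> 0 <= h ->
  sg_int (t + h) = sg_int t + sg0 t (sg_int h).
Proof.
move=> t0 h0; apply/eqP; rewrite -subr_eq0; apply/eqP.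
have M0 : 0 <= M by apply: le_trans M1.
apply: (@norm_le_eps _ _ _ (2 + M + M + M * (M * `|f|))).
  by rewrite addr_ge0 ?mulr_ge0//; lra.
move=> e e0; have [d d0 hd] := @sg0_cont (sg_int h) e e0.
have [N1 hN1] := sg_intP (addr_ge0 t0 h0) e0.
have [N2 hN2] := sg_intP t0 e0.
have [N3 hN3] := sg_intP h0 e0.
have de0 : 0 < Num.min e d by rewrite lt_min e0 d0.
have [N4 hN4] := dyad_small de0.
pose n := maxn (maxn N1 N2) (maxn N3 N4).
have h1 := hN1 n (leq_trans (leq_maxl _ _) (leq_maxl _ _)).
have h2 := hN2 n (leq_trans (leq_maxr _ _) (leq_maxl _ _)).
have h3 := hN3 n (leq_trans (leq_maxl _ _) (leq_maxr _ _)).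
have := hN4 n (leq_trans (leq_maxr _ _) (leq_maxr _ _)).
rewrite le_min => /andP[de dd].
have dn0 := dyad_gt0 n.
have /andP[a1 a2] := dyadn_itv n t0; have /andP[b1 b2] := dyadn_itv n h0.
set s := (dyadn n t)%:R * dyad n in a1 a2.
have s0 : 0 <= s by rewrite mulr_ge0// ltW.
(* Truncating [t] and [h] separately loses at most one cell. *)
have le1 : (dyadn n t + dyadn n h <= dyadn n (t + h))%N.
  by apply: dyadn_le; rewrite ?addr_ge0// natrD mulrDl lerD.
have le2 : (dyadn n (t + h) < (dyadn n t + dyadn n h).+2)%N.
  apply: dyadn_ge; rewrite ?addr_ge0// -natr1 -natr1 !mulrDl mul1r natrD mulrDl.
  by rewrite -/s; lra.
pose j := (dyadn n (t + h) - (dyadn n t + dyadn n h))%N.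
have j1 : (j <= 1)%N by rewrite leq_subLR addn1.
have E1 : rint n (t + h) = rint n t + sg0 s (rint n h) +
    sg0 ((dyadn n t + dyadn n h)%:R * dyad n) (rsum (dyad n) j).
  by rewrite /rint -(subnKC le1) !rsumD ?(ltW dn0).
have h4 : `|sg0 ((dyadn n t + dyadn n h)%:R * dyad n) (rsum (dyad n) j)| <=
    M * (M * `|f|) * e.
  apply: le_trans (sg0_norm _ _) _; rewrite -mulrA ler_wpM2l// mulrC.
  apply: le_trans (rsum_norm _ (ltW dn0)) _; rewrite ler_wpM2r ?mulr_ge0//.
  apply: le_trans de; rewrite ger_pMl//.
  by rewrite -[leRHS]/(1%:R) ler_nat.
have h5 : `|sg0 s (rint n h - sg_int h)| <= M * e.
  by apply: le_trans (sg0_norm _ _) _; rewrite ler_wpM2l// distrC.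
have h6 : `|sg0 s (sg0 (t - s) (sg_int h) - sg_int h)| <= M * e.
  apply: le_trans (sg0_norm _ _) _; rewrite ler_wpM2l//; apply: hd.
  by rewrite ltrBlDl; apply: lt_le_trans a2 _; rewrite lerD2l.
have E2 : sg0 t (sg_int h) = sg0 s (sg0 (t - s) (sg_int h)).
  by rewrite -sg0D ?subr_ge0// [s + _]addrC subrK.
rewrite !sg0_sub in h5 h6.
have -> : sg_int (t + h) - (sg_int t + sg0 t (sg_int h)) =
  (sg_int (t + h) - rint n (t + h)) +
  ((rint n t - sg_int t) +
   ((sg0 s (rint n h) - sg0 s (sg_int h)) +
    ((sg0 s (sg_int h) - sg0 s (sg0 (t - s) (sg_int h))) +
     sg0 ((dyadn n t + dyadn n h)%:R * dyad n) (rsum (dyad n) j)))).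
  rewrite E2 E1.
  set x1 := sg_int (t + h); set x2 := sg_int t; set x3 := sg0 s (sg0 _ _).
  set x4 := rint n t; set x5 := sg0 s (rint n h); set x6 := sg0 s (sg_int h).
  set x7 := sg0 _ (rsum _ _).
  have -> : x4 - x2 + (x5 - x6 + (x6 - x3 + x7)) = x4 + x5 + x7 - (x2 + x3).
    rewrite -[x6 - x3 + x7]addrA subrKA addrACA [- x3 + x7]addrC [- x2 + _]addrCA.
    by rewrite -opprD addrA.
  by rewrite subrKA.
rewrite distrC in h2; rewrite distrC in h6.
have -> : (2 + M + M + M * (M * `|f|)) * e =
  e + (e + (M * e + (M * e + M * (M * `|f|) * e))) by ring.
by do 4 (apply: le_trans (ler_normD _ _) _; apply: lerD => //).
Qed.

(** The cocycle identity read in both orders turns [S h (sg_int t) - sg_int t] into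
    [S t (sg_int h) - sg_int h], and [h^-1 *: sg_int h] tends to [f]. *)
Lemma generator_sg_int t : 0 < t -> generator S (sg_int t) (S t f - f).
Proof.
move=> t0; apply/cvg_right0_normP => e e0.
have M0 : 0 <= M by apply: le_trans M1.
have eM0 : 0 < e / (M + 1) by rewrite divr_gt0//; lra.
have [d d0 hd] := @sg0_cont f _ eM0; exists d => // h /andP[h0 hd'].
have -> : S h (sg_int t) - sg_int t = S t (sg_int h) - sg_int h.
  have := sg_int_cocycle (ltW h0) (ltW t0).
  rewrite addrC (sg_int_cocycle (ltW t0) (ltW h0)) !sg0_gt0// => eq.
  by apply/eqP; rewrite subr_eq addrAC -subr_eq opprK addrC eq addrC.
have -> : S t f - f - h^-1 *: (S t (sg_int h) - sg_int h) =
    h^-1 *: ((sg_int h - h *: f) - S t (sg_int h - h *: f)).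
  rewrite (sg_addB SL)// (sg_addZ SL)// !scalerBr !scalerA mulVf ?gt_eqF// !scale1r.
  by rewrite !opprB addrACA [RHS]addrACA; congr (_ + _); rewrite addrC.
rewrite normrZ gtr0_norm ?invr_gt0// ler_pdivrMl//.
have hh : `|sg_int h - h *: f| <= h * (e / (M + 1)).
  by apply: sg_int_approx (ltW h0) _ => s sh; apply: hd; apply: le_lt_trans hd'.
apply: le_trans (ler_normB _ _) _.
have := SM t0 (sg_int h - h *: f) => hS.
have hM : M * `|sg_int h - h *: f| <= M * (h * (e / (M + 1))) by rewrite ler_wpM2l.
have -> : h * e = h * (e / (M + 1)) + M * (h * (e / (M + 1))).
  by field; rewrite gt_eqF//; lra.
lra.
Qed.

End Cocycle.

Lemma generator_dual_ker_invariant (phi : E -> R) : lin_form phi ->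
  (forall f g, generator S f g -> phi g = 0) ->
  forall t f, 0 < t -> phi (S t f) = phi f.
Proof.
move=> lin phi0 t f t0; have := phi0 _ _ (@generator_sg_int f _ t0).
by rewrite lin_formB// => /eqP; rewrite subr_eq0 => /eqP.
Qed.

End Generator.

(** * Invariant functionals and convergence *)

Section Dual.
Context {R : realType} {E : normedModType R}.

Lemma is_dual_bounded (phi : E -> R) : is_dual phi ->
  exists2 c, 0 <= c & forall f, `|phi f| <= c * `|f|.
Proof.
move=> [lin cont].
have /cvgrPdist_le/(_ 1 ltr01)/nbhs_ballP[d /= d0 hd] := cont 0.
exists (2 / d) => [|f]; first by rewrite divr_ge0// ltW.
have [->|f0] := eqVneq f 0; first by rewrite lin_form0// !normr0 mulr0.
have nf : 0 < `|f| by rewrite normr_gt0.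
pose a := d / (2 * `|f|); have a0 : 0 < a by rewrite divr_gt0// mulr_gt0.
have := hd (a *: f); rewrite -ball_normE /ball_/= sub0r normrN normrZ gtr0_norm//.
have -> : a * `|f| = d / 2 by rewrite /a; field; rewrite gt_eqF.
have d2 : d / 2 < d by lra.
move=> /(_ d2); rewrite lin_form0// sub0r normrN lin_formZ// normrM gtr0_norm//.
rewrite mulrC -ler_pdivlMr// => /le_trans; apply.
by rewrite /a le_eqVlt; apply/orP; left; apply/eqP; field; rewrite !gt_eqF.
Qed.

Lemma bounded_is_dual (phi : E -> R) (c : R) : lin_form phi ->
  (forall f, `|phi f| <= c * `|f|) -> is_dual phi.
Proof.
move=> lin pc; split=> // x; apply/cvgrPdist_le => e e0.
have c1 : 0 < `|c| + 1 by rewrite ltr_pwDr.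
apply/nbhs_ballP; exists (e / (`|c| + 1)) => /=; first by rewrite divr_gt0.
move=> y; rewrite -ball_normE /ball_/= => xy.
rewrite -lin_formB//; apply: le_trans (pc _) _.
have := ltW xy; rewrite ler_pdivlMr// mulrC => /(le_trans _); apply.
by rewrite ler_wpM2r//; have := ler_norm c; lra.
Qed.

End Dual.

(** Compactness of [[- C, C]] yields a cluster point, which for an ultrafilter is a limit. *)
Lemma ultra_bounded_cvg (R : realType) (T : Type) (U : set_system T)
  (UU : UltraFilter U) (u : T -> R) (C : R) :
  U [set t | `|u t| <= C] -> cvg (u @ U).
Proof.
move=> uC; have UA : (u @ U) `[- C, C]%classic.
  by apply: (@filterS _ U) uC => t /=; rewrite in_itv/= -ler_norml.
have [l [_ cl]] := @segment_compact R (- C) C (u @ U) _ UA.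
apply/cvg_ex; exists l => B nB.
have [//|nUB] := in_ultra_setVsetC (u @^-1` B) UU.
by have [z [/= nBz Bz]] := cl (~` B) B nUB nB.
Qed.

Section Convergence.
Context {R : realType} {E : completeNormedModType R} (L : banach_lattice E).
Variables (S : R -> E -> E) (M : R).
Hypotheses (M1 : 1 <= M)
  (SL : forall t, 0 < t -> forall (a : R) x y, S t (a *: x + y) = a *: S t x + S t y)
  (SD : forall s t, 0 < s -> 0 < t -> forall f, S (s + t) f = S t (S s f))
  (SM : forall t, 0 < t -> forall f, `|S t f| <= M * `|f|)
  (S0 : forall f, S^~ f @ 0^'+ --> f)
  (Spos : sg_positive L S) (enc : eventually_norm_continuous S).
Local Notation pos := (bl_pos L).

(** Turns the kernel into a fixed-point condition, the form in which trajectories produce its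
    elements. *)
Lemma ker_dual_genP phi : ker_dual_gen S phi <->
  is_dual phi /\ forall t f, 0 < t -> phi (S t f) = phi f.
Proof.
split=> [[dphi k0]|[dphi inv]].
  by split=> //; apply: (generator_dual_ker_invariant M1) => //; case: dphi.
split=> // f g /cvg_right0_normP fg; have [c c0 phic] := is_dual_bounded dphi.
have lin : lin_form phi by case: dphi.
apply: (@norm_le_eps R R^o _ c) => // e e0; have [d d0 hd] := fg e e0.
have t0 : 0 < d / 2 by lra.
have td : 0 < d / 2 < d by lra.
have hd2 := hd _ td.
have z0 : phi ((d / 2)^-1 *: (S (d / 2) f - f)) = 0.
  by rewrite lin_formZ// lin_formB// inv// subrr mulr0.
rewrite -[phi g]subr0 -z0 -lin_formB//; apply: le_trans (phic _) _.
by rewrite ler_wpM2l.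
Qed.

Lemma ker_genP f : ker_gen S f <-> forall t, 0 < t -> S t f = f.
Proof.
split=> [|fix_f]; first exact: (generator_ker_fixed M1).
apply/cvg_right0_normP => e e0; exists 1 => // t /andP[t0 _].
by rewrite fix_f// subrr scaler0 subrr normr0 ltW.
Qed.

Lemma annihilated_cvg0 f : (forall phi, ker_dual_gen S phi -> phi f = 0) ->
  S^~ f @ +oo --> 0.
Proof.
move=> ann; apply: contrapT => ncv.
have [e e0 he] : exists2 e : R, 0 < e & forall A, exists2 t, A < t & e < `|S t f|.
  apply: contrapT => nex; apply: ncv; apply/cvg_pinfty_normP => e e0.
  apply: contrapT => nA; apply: nex; exists e => // A.
  apply: contrapT => nt; apply: nA; exists A => t At.
  rewrite sub0r normrN leNgt; apply/negP => et; apply: nt; by exists t.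
(* Restricting to these times keeps the limit functional at least [e] at [f]. *)
pose D := [set t : R | e < `|S t f|].
have FF : ProperFilter (within D (pinfty_nbhs R)).
  split; last exact: within_filter.
  by move=> [A [_ hA]]; have [t At et] := he A; exact: (hA t At et).
have [U [UU FU]] := ultraFilterLemma FF.
have Ugt r : U [set t | r < t].
  apply: FU; exists r; split; first exact: num_real.
  by move=> t rt _.
have UD : U D.
  by apply: FU; exists 0; split; [exact: num_real|move=> t _].
have /choice[psi psiP] := fun t => norming_functional (S t f).
have psiL t : lin_form (psi t) by have [] := psiP t.
have psi1 t g : `|psi t g| <= `|g| by have [_ + _] := psiP t; apply.
(* The meaningful times are [t > r]; they form a member of [U]. *)
pose u r g t := psi t (S (t - r) g).
have ub r g : U [set t | `|u r g t| <= M * `|g|].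
  apply: filterS (Ugt r) => t /= rt; apply: le_trans (psi1 _ _) _.
  by apply: SM; rewrite subr_gt0.
pose Phi r g : R := lim (u r g @ U).
have uPhi r g : u r g @ U --> Phi r g by exact: ultra_bounded_cvg (ub r g).
have uniq r g v l : U [set t | u r g t = v t] -> v @ U --> l -> Phi r g = l.
  move=> uv vl; apply: (@cvg_unique _ (@norm_hausdorff _ R^o) (v @ U)) => //.
  apply: cvg_trans (uPhi r g); apply: near_eq_cvg.
  by apply: filterS uv => t /= ->.
have trPhi : traj S Phi.
  split.
  - move=> r a x y; apply: (uniq _ _ (fun t => a * u r x t + u r y t)).
      apply: filterS (Ugt r) => t /= rt.
      by rewrite /u SL ?subr_gt0// psiL.
    by apply: cvgD => //; apply: cvgMr.
  - exists M => r g; rewrite ler_norml; apply/andP; split.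
      apply: (cvgr_to_ge (uPhi r g)); apply: filterS (ub r g) => t /=.
      by rewrite ler_norml => /andP[].
    apply: (cvgr_to_le (uPhi r g)); apply: filterS (ub r g) => t /=.
    by rewrite ler_norml => /andP[].
  - move=> r t g t0; apply: (uniq _ _ (u r g)) => //.
    apply: filterS (Ugt (r + t)) => s /= rts.
    have s0 : 0 < s - (r + t) by rewrite subr_gt0.
    by rewrite /u -SD//; congr (psi s (S _ g)); ring.
have [lin [c Pc] _] := trPhi.
have : Phi 0 f = 0.
  apply: ann; apply/ker_dual_genP; split; first exact: bounded_is_dual (Pc 0).
  by move=> t g t0; exact: (traj_invariant M1 SL SD SM Spos).
suff : e <= Phi 0 f by lra.
apply: (cvgr_to_ge (uPhi 0 f)); apply: filterS UD => t /= et.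
by rewrite /u subr0; have [_ _ ->] := psiP t; exact: ltW.
Qed.

(** The constant trajectory [phi] is the difference of the positive trajectories [P] and [P - phi],
    both invariant; [phi f <> 0] keeps one of them from vanishing at [f]. *)
Lemma ker_dual_gen_pos phi : ker_dual_gen S phi -> (exists f, phi f <> 0) ->
  exists chi, ker_dual_gen S chi /\ dual_strict_pos L chi.
Proof.
move=> kphi; have /ker_dual_genP[dphi inv] := kphi => -[f phif].
have lin : lin_form phi by case: dphi.
have [c c0 phic] := is_dual_bounded dphi.
pose X (_ : R) f := phi f.
have trX : traj S X by split => //; exists c.
have [P [trP Pb P0 XP _]] := traj_pospart M1 SL SD SM Spos trX c0 (fun _ => phic).
pose Q r f := P r f - X r f.
have trQ : traj S Q by exact: traj_sub.
have Q0 : tpos L Q by move=> r g g0; rewrite subr_ge0; exact: XP.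
have ker Y : traj S Y -> ker_dual_gen S (Y 0).
  move=> trY; have [linY [d Yd] _] := trY.
  apply/ker_dual_genP; split; first exact: bounded_is_dual (Yd 0).
  by move=> t g t0; exact: (traj_invariant M1 SL SD SM Spos).
have [P0f|Pf] := pselect (P 0 f = 0).
  exists (Q 0); split; first exact: ker.
  split; first exact: Q0.
  by exists f; rewrite /Q P0f /X; lra.
by exists (P 0); split; [exact: ker|split; [exact: P0|exists f]].
Qed.

End Convergence.

(** * Quasi-interior points and fixed vectors *)

Section QuasiInterior.
Context {R : realType} {E : normedModType R} (L : banach_lattice E).
Local Notation pos := (bl_pos L).
Local Notation pp := (pospart L).

Lemma pospart_id x : pos x -> pp x = x.
Proof.
move=> x0; apply: (bl_le_anti (b := L)); apply/bl_subr_pos; last exact: pospart_ge.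
by apply: pospart_least => //; rewrite subrr; exact: bl_pos0.
Qed.

Lemma pospart_mono x y : pos (y - x) -> pos (pp y - pp x).
Proof.
move=> yx; apply: pospart_least; first exact: pospart_pos.
by rewrite -[pp y](subrK y) -addrA; apply: bl_posD => //; exact: pospart_ge.
Qed.

Lemma norm_pospart_le x y : pos y -> pos (y - x) -> `|pp x| <= `|y|.
Proof.
move=> y0 yx; apply: (bl_norm_le (pospart_pos L x)).
exact: pospart_least.
Qed.

(** Let [q x] be the infimum over [s >= 0] of the norm of [(x - s u)^+]. Hahn-Banach gives a
    positive functional below [q] with value [q v] at [v]; it is nonpositive at [u], so it must be
    zero and [q v = 0]. Since [v - v /\ (n u) = (v - n u)^+], this is the required convergence. *)
Lemma quasi_interior_of_dual u : pos u ->
  (forall phi, is_dual phi -> dual_strict_pos L phi -> 0 < phi u) ->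
  quasi_interior L u.
Proof.
move=> u0 strict; split=> // v v0.
pose F (s : R) x := `|pp (x - s *: u)|.
have [] := @sublinear_inf R E R [set s | 0 <= s] F.
- by exists 0 => /=.
- by move=> x; exists 0 => s _; exact: normr_ge0.
- move=> s t x y /= s0 t0; exists (s + t); first exact: addr_ge0.
  have -> : F (s + t) (x + y) = `|pp ((x - s *: u) + (y - t *: u))|.
    by rewrite /F scalerDl opprD addrACA.
  apply: le_trans (ler_normD _ _); apply: norm_pospart_le.
    by apply: bl_posD; exact: pospart_pos.
  rewrite opprD addrACA.
  by apply: bl_posD; exact: pospart_ge.
- move=> s a x /= s0 a0; exists (a * s); first by rewrite mulr_ge0// ltW.
  rewrite /F -scalerA -scalerBr -{2}(gtr0_norm a0) -normrZ.
  apply: norm_pospart_le; first exact: bl_posZ (ltW a0) (pospart_pos _ _).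
  by rewrite -scalerBr; exact: bl_posZ (ltW a0) (pospart_ge _ _).
set q := fun x => inf _; move=> sq qF.
have qn x : q x <= `|pp x|.
  by apply: le_trans (qF 0 x _) _ => //=; rewrite /F scale0r subr0.
have [phi [lin phiq phiv]] := hahn_banach v sq.
have phi_pos : dual_pos L phi.
  move=> f f0; have := le_trans (phiq (- f)) (qn (- f)).
  by rewrite lin_formN// pospartN pospart_id// subrr normr0; lra.
have dphi : is_dual phi.
  apply: (@bounded_is_dual _ _ _ 1) => // x; rewrite mul1r.
  have b y : phi y <= `|y|.
    exact: le_trans (le_trans (phiq y) (qn y)) (norm_pospart L y).
  by have := b x; have := b (- x); rewrite normrN lin_formN// ler_norml; lra.
have phiu : phi u <= 0.
  apply: le_trans (phiq u) _; apply: le_trans (qF 1 u _) _ => //=.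
  by rewrite /F scale1r subrr pospart_id ?normr0//; exact: bl_pos0.
have qv : q v = 0.
  rewrite -phiv; apply: contrapT => phiv0.
  have : dual_strict_pos L phi by split=> //; exists v.
  by move=> /(strict _ dphi); lra.
apply/cvgrPdist_le => e e0.
have [_ [s /= s0 <-] hs] : exists2 y, [set F s v | s in [set s | 0 <= s]] y & y < e.
  have hinf : has_inf [set F s v | s in [set s | 0 <= s]].
    split; first by exists (F 0 v); exists 0 => /=.
    by exists 0 => _ [s _ <-]; exact: normr_ge0.
  have [y yA] := inf_adherent e0 hinf; rewrite -/(q v) qv add0r => ye.
  by exists y.
exists (Num.truncn s).+1 => // n /= sn; rewrite bl_meetE opprB addrC subrK.
apply: le_trans (ltW hs); apply: bl_norm_le; first exact: pospart_pos.
apply: pospart_mono; rewrite opprB addrC subrKA -scalerBl.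
apply: bl_posZ => //; rewrite subr_ge0; apply: ltW.
by apply: lt_le_trans (truncnS_gt s) _; rewrite ler_nat.
Qed.

End QuasiInterior.

(** * Fixed vectors of an irreducible semigroup *)

Section Fixed.
Context {R : realType} {E : normedModType R} (L : banach_lattice E).
Variables (S : R -> E -> E).
Hypotheses
  (SL : forall t, 0 < t -> forall (a : R) x y, S t (a *: x + y) = a *: S t x + S t y)
  (Spos : sg_positive L S) (irr : sg_irreducible L S).
Variable (phi : E -> R).
Hypotheses (dphi : is_dual phi) (inv : forall t f, 0 < t -> phi (S t f) = phi f)
  (phi0 : dual_strict_pos L phi).
Local Notation pos := (bl_pos L).

Let fixedv f := forall t, 0 < t -> S t f = f.

(** Invariance removes [S t] from the irreducibility condition. *)
Lemma invariant_strictly_positive : strictly_positive L phi.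
Proof.
split=> // f f0; have [t [t0]] := irr f0 dphi phi0.
by rewrite inv.
Qed.

Lemma fixed_quasi_interior u : fixedv u -> pos u -> u <> 0 -> quasi_interior L u.
Proof.
move=> fu u0 un0; apply: quasi_interior_of_dual => // chi dchi chi0.
have [t [t0]] := irr (conj u0 un0) dchi chi0.
by rewrite fu.
Qed.

(** Positivity gives [S t x^+ >= x^+]; the strictly positive invariant [phi] vanishes on the
    difference, which is therefore 0. *)
Lemma fixed_pospart x : fixedv x -> fixedv (pospart L x).
Proof.
move=> fx t t0; have [lin _] := dphi.
have ge : pos (S t (pospart L x) - pospart L x).
  apply: pospart_least; first by apply: Spos => //; exact: pospart_pos.
  rewrite -{2}(fx t t0); apply: (sg_le SL Spos) => //; exact: pospart_ge.
apply/eqP; rewrite -subr_eq0; apply/eqP; apply: contrapT => n0.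
have [_ /(_ _ (conj ge n0))] := invariant_strictly_positive.
by rewrite lin_formB// inv// subrr ltxx.
Qed.

(* The two parts of a fixed vector are disjoint, and a nonzero one would be
   quasi-interior. *)
Lemma fixed_total x : fixedv x -> pos x \/ pos (- x).
Proof.
move=> fx; have [xp|xp] := pselect (pospart L x = 0).
  by right; have := pospart_ge L x; rewrite xp sub0r.
left; have qi := fixed_quasi_interior (fixed_pospart fx) (pospart_pos L x) xp.
have [_ /(_ _ (pospart_pos L (- x)))] := qi.
suff -> : (fun n : nat => bl_meet L (pospart L (- x)) (n%:R *: pospart L x)) = fun=> 0.
  move=> h; have z : pospart L (- x) = 0.
    exact: (cvg_unique (@norm_hausdorff _ E) h (cvg_cst 0)).
  by have := pospart_ge L (- x); rewrite z sub0r opprK.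
apply/funext => n; rewrite bl_meetE.
set v := pospart L (- x); set u := pospart L x; set w := v - _.
have v0 : pos v by exact: pospart_pos.
have u0 : pos u by exact: pospart_pos.
have n0 : 0 <= n%:R :> R by [].
have nu0 : pos (n%:R *: u) by exact: bl_posZ.
have w0 : pos w by apply: pospart_least => //; rewrite opprB addrC subrK.
have wv : pos (v - w) by rewrite opprB addrC subrK; exact: pospart_pos.
have wu : pos (n%:R *: u - w).
  by have := pospart_ge L (v - n%:R *: u); rewrite /w !opprB addrCA.
clearbody w; have k0 : 0 < n.+1%:R :> R by rewrite ltr0n.
have kV0 : 0 <= n.+1%:R^-1 :> R by rewrite invr_ge0.
(* From [w <= n u] and [w <= v], the rescaled [w] lies below both [u] and [v]; dividing by [n + 1]
   also covers [n = 0]. *)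
suff /eqP : n.+1%:R^-1 *: w = 0.
  by rewrite scaler_eq0 invr_eq0 gt_eqF//= => /eqP.
apply: (@pospart_disjoint _ _ L x); first exact: bl_posZ.
- have -> : u - n.+1%:R^-1 *: w =
      n.+1%:R^-1 *: (n%:R *: u - w) + n.+1%:R^-1 *: u.
    rewrite scalerBr addrAC -scalerDr -[X in _ *: (_ + X)]scale1r -scalerDl natr1.
    by rewrite scalerA mulVf ?scale1r// gt_eqF.
  by apply: bl_posD; exact: bl_posZ.
- have -> : v - n.+1%:R^-1 *: w = (v - w) + (1 - n.+1%:R^-1) *: w.
    by rewrite scalerBl scale1r addrA subrK.
  apply: bl_posD => //; apply: bl_posZ => //.
  by rewrite subr_ge0 invf_le1// ler1n.
Qed.

(** The coefficient makes [phi] vanish on the difference, a fixed vector; having a sign, it is 0 by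
    strict positivity of [phi]. *)
Lemma fixed_dim1 u x : fixedv u -> pos u -> u <> 0 -> fixedv x ->
  x = (phi x / phi u) *: u.
Proof.
move=> fu u0 un0 fx; have [lin _] := dphi.
have [_ sp] := invariant_strictly_positive.
have pu := sp _ (conj u0 un0).
set y := (_ *: u); have fy : fixedv (x - y).
  by move=> t t0; rewrite (sg_addB SL)// fx// /y (sg_addZ SL)// fu.
have phiy : phi (x - y) = 0.
  by rewrite lin_formB// lin_formZ// mulfVK ?subrr// gt_eqF.
apply/eqP; rewrite -subr_eq0; apply/eqP; apply: contrapT => n0.
have [h|h] := fixed_total fy.
  by have := sp _ (conj h n0); rewrite phiy ltxx.
have n0' : - (x - y) <> 0 by move=> /eqP; rewrite oppr_eq0 => /eqP.
by have := sp _ (conj h n0'); rewrite lin_formN// phiy oppr0 ltxx.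
Qed.

End Fixed.

(** * The four cases *)

Unset Implicit Arguments.

Theorem theorem3p6 (R : realType) (E : completeNormedModType R)
  (L : banach_lattice E) (S : R -> E -> E) :
  C0_semigroup S -> sg_bounded S -> sg_positive L S -> sg_irreducible L S ->
  eventually_norm_continuous S ->
  (ddim0 (ker_dual_gen S) /\ (forall f, S^~ f @ +oo --> 0))
  \/ (ddim1 (ker_dual_gen S) /\ dim1 (ker_gen S) /\
      exists u phi, quasi_interior L u /\ strictly_positive L phi /\
        forall f, S^~ f @ +oo --> phi f *: u)
  \/ (ddim1 (ker_dual_gen S) /\ dim0 (ker_gen S) /\ ~ strongly_convergent S)
  \/ (ddim_ge2 (ker_dual_gen S) /\ ~ strongly_convergent S).
Proof.
move=> [SLc [SD [_ S0]]] [M0 SM0] Spos irr enc.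
pose M := Num.max M0 1.
have M1 : 1 <= M by rewrite le_max lexx orbT.
have SL t : 0 < t -> forall (a : R) (x y : E), S t (a *: x + y) = a *: S t x + S t y.
  by move=> t0; have [] := SLc t t0.
have SM t : 0 < t -> forall f, `|S t f| <= M * `|f|.
  by move=> t0 f; apply: le_trans (SM0 t t0 f) _; rewrite ler_wpM2r// le_max lexx.
have kdP := ker_dual_genP M1 SL SD SM S0.
have kgP := ker_genP M1 SL SD SM.
have cv0 := annihilated_cvg0 M1 SL SD SM S0 Spos enc.
have dpos := ker_dual_gen_pos M1 SL SD SM S0 Spos enc.
have late (A : R) : exists2 s, 0 < s & A < s.
  by exists (Num.max A 0 + 1); rewrite ltr_pwDr// le_max lexx ?orbT.
(* This link between the two kernels excludes strong convergence in the last two cases. *)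
have limK f g : S^~ f @ +oo --> g -> ker_gen S g /\
    forall phi, ker_dual_gen S phi -> phi f = phi g.
  move=> /cvg_pinfty_normP fg; split.
    apply/kgP => t t0; apply/eqP; rewrite -subr_eq0; apply/eqP.
    apply: (@norm_le_eps _ _ _ (M + 1)); first by lra.
    move=> e e0; have [A hA] := fg e e0.
    have [s s0 As] := late A.
    have -> : S t g - g = S t (g - S s f) - (g - S (s + t) f).
      by rewrite (sg_addB SL)// SD// opprB addrA subrK.
    apply: le_trans (ler_normB _ _) _; rewrite mulrDl mul1r lerD//.
      by apply: le_trans (SM t t0 _) _; rewrite ler_wpM2l ?(le_trans _ M1)// hA.
    by apply: hA; rewrite ltr_wpDr// ltW.
  move=> phi /kdP[dphi inv]; have [c c0 phic] := is_dual_bounded dphi.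
  have lin : lin_form phi by case: dphi.
  apply/eqP; rewrite -subr_eq0; apply/eqP.
  apply: (@norm_le_eps R R^o _ c) => // e e0; have [A hA] := fg e e0.
  have [s s0 As] := late A.
  rewrite -(inv s f s0) -lin_formB//; apply: le_trans (phic _) _.
  by rewrite ler_wpM2l// distrC hA.
have [d0|nd0] := pselect (ddim0 (ker_dual_gen S)).
  by left; split=> // f; apply: cv0 => phi kphi; exact: d0.
right.
have [psi kpsi [f0 psif0]] : exists2 psi, ker_dual_gen S psi & exists f, psi f <> 0.
  apply: contrapT => nex; apply: nd0 => phi kphi f; apply: contrapT => phif.
  by apply: nex; exists phi => //; exists f.
have [phi [kphi phipos]] := dpos _ kpsi (ex_intro _ f0 psif0).
have /kdP[dphi inv] := kphi; have lin : lin_form phi by case: dphi.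
have sp := invariant_strictly_positive irr dphi inv phipos.
have posfix x : ker_gen S x -> x <> 0 ->
    exists u, [/\ ker_gen S u, bl_pos L u & u <> 0].
  move=> kx x0; have fx : forall t, 0 < t -> S t x = x by apply/kgP.
  have fNx t : 0 < t -> S t (- x) = - x.
    by move=> t0; rewrite -scaleN1r (sg_addZ SL)// fx.
  have [h|h] := fixed_total SL Spos irr dphi inv phipos fx; first by exists x.
  exists (- x); split=> //; first exact/kgP.
  by move=> /eqP; rewrite oppr_eq0 => /eqP.
have dimK u : ker_gen S u -> bl_pos L u -> u <> 0 ->
    forall x, ker_gen S x -> x = (phi x / phi u) *: u.
  move=> /kgP fu u0 un0 x /kgP fx.
  exact: (fixed_dim1 SL Spos irr dphi inv phipos).
have dimK0 : ~ dim0 (ker_gen S) -> exists u, [/\ ker_gen S u, bl_pos L u & u <> 0].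
  move=> nk; apply: contrapT => nex; apply: nk => x kx; apply: contrapT => x0.
  exact: nex (posfix x kx x0).
have [d1|nd1] := pselect (ddim1 (ker_dual_gen S)); last first.
  right; right; split.
    have [chi kchi nchi] : exists2 chi, ker_dual_gen S chi &
        forall c : R, exists f, chi f <> c * phi f.
      apply: contrapT => nex; apply: nd1; exists phi; split=> //; split.
        by case: phipos.
      move=> chi kchi; apply: contrapT => nc; apply: nex; exists chi => // c.
      by apply: contrapT => nf; apply: nc; exists c => f; apply: contrapT => h;
        apply: nf; exists f.
    exists phi, chi; split=> //; split=> // a b ab.
    have b0 : b = 0.
      apply: contrapT => /eqP b0; have [f] := nchi (- a / b); apply.
      have := ab f => h; apply: (mulfI b0); rewrite mulrA mulrCA divff// mulr1.
      lra.
    split=> //; case: phipos => _ [f /eqP phif]; have := ab f.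
    by rewrite b0 mul0r addr0 => /eqP; rewrite mulf_eq0 (negbTE phif) orbF => /eqP.
  (* Under convergence all limits are multiples of one [u], so every [chi] in the dual kernel equals
     [chi u / phi u] times [phi]. *)
  move=> sc; apply: nd1; exists phi; split=> //; split; first by case: phipos.
  move=> chi kchi; case: phipos => phi_pos [f phif].
  have [g fg] := sc f; have [kg pg] := limK _ _ fg.
  have g0 : g <> 0.
    by move=> gz; apply: phif; rewrite (pg _ kphi) gz lin_form0.
  have [u [ku u0 un0]] := posfix g kg g0.
  exists (chi u / phi u) => f'; have [g' fg'] := sc f'; have [kg' pg'] := limK _ _ fg'.
  have linc : lin_form chi by case: kchi => -[].
  rewrite (pg' _ kchi) (pg' _ kphi) {1}(dimK u ku u0 un0 _ kg') lin_formZ//.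
  by ring.
have [k0|nk0] := pselect (dim0 (ker_gen S)).
  right; left; split=> //; split=> // sc.
  (* The limit would be a fixed vector, hence 0, although [phi] keeps its nonzero value along the
     orbit. *)
  case: phipos => phi_pos [f phif]; have [g fg] := sc f.
  have [kg pg] := limK _ _ fg; apply: phif.
  by rewrite (pg _ kphi) (k0 _ kg) lin_form0.
left; split=> //; have [u [ku u0 un0]] := dimK0 nk0.
have fu : forall t, 0 < t -> S t u = u by apply/kgP.
have pu : 0 < phi u by case: sp => _; apply.
split.
  by exists u; split=> //; split=> // x kx; exists (phi x / phi u); exact: dimK.
(* The normalisation gives the functional the value 1 at [u]. *)
exists u, (fun f => (phi u)^-1 * phi f); split.
  exact: (fixed_quasi_interior irr fu).
split.
  have [c c0 phic] := is_dual_bounded dphi.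
  split.
    apply: (@bounded_is_dual _ _ _ ((phi u)^-1 * c)).
      by move=> a x y; rewrite lin; ring.
    move=> f; rewrite normrM gtr0_norm ?invr_gt0// -mulrA ler_wpM2l//.
    by rewrite invr_ge0 ltW.
  by move=> f fpos; rewrite mulr_gt0 ?invr_gt0//; case: sp => _; apply.
(* Removing the component along [u] leaves a vector annihilated by [phi], hence by the whole
   one-dimensional dual kernel. *)
move=> f; have z0 : S^~ (f - ((phi u)^-1 * phi f) *: u) @ +oo --> 0.
  apply: cv0 => chi kchi; have linc : lin_form chi by case: kchi => -[].
  case: d1 => psi' [kpsi' [_ span]].
  have [a phia] := span _ kphi; have [b chib] := span _ kchi.
  have linp : lin_form psi' by case: kpsi' => -[].
  have pu0 : phi u != 0 by rewrite gt_eqF.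
  rewrite chib lin_formB// lin_formZ//.
  have : a * (psi' f - (phi u)^-1 * phi f * psi' u) = 0.
    by rewrite mulrBr -phia mulrCA -phia mulrAC mulVf// mul1r subrr.
  move=> /eqP; rewrite mulf_eq0 => /orP[/eqP a0|/eqP ->]; last by rewrite mulr0.
  by move: pu0; rewrite phia a0 mul0r eqxx.
apply/cvg_pinfty_normP => e e0; have /cvg_pinfty_normP/(_ e e0)[A hA] := z0.
exists (Num.max A 0) => t; rewrite gt_max => /andP[At t0].
by have := hA t At; rewrite sub0r (sg_addB SL)// (sg_addZ SL)// fu// opprB.
Qed.
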